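(* Let $\alpha\in\mathbb C\setminus\mathbb R$, let $W\subset\mathbb C^{2n}$ be a Lagrangian subspace, and let $h\in\mathcal L(\mathrm{CSp}(n,\mathbb C))$ be holomorphic at $\alpha$. Define $W'=h(\alpha)^{-1}W$. Then the loop $$p_{\alpha,W}\,h\,p_{\alpha,W'}^{-1}$$ is again holomorphic at $\alpha$.
   Context: Let $\omega(v,w)={}^tvJw$ on $\mathbb C^{2n}$, with $J=\begin{pmatrix}0&I_n\\-I_n&0\end{pmatrix}$, and $\mathrm{CSp}(n,\mathbb C)=\{A\in \mathrm{GL}(2n,\mathbb C): \omega(Av,Aw)=c\,\omega(v,w)\ \forall v,w,\text{ for some }c\in\mathbb C\}$. $\mathcal L(\mathrm{CSp}(n,\mathbb C))$ is the group of holomorphic maps $g:U\to \mathrm{CSp}(n,\mathbb C)$ with $U\subset\mathbb{CP}^1$ open and dense; loops agreeing on an open dense set are identified, and multiplication is pointwise. A loop is holomorphic at $\alpha$ if it extends to a holomorphic $\mathrm{CSp}(n,\mathbb C)$-valued map near $\alpha$. A Lagrangian subspace is an $n$-dimensional complex subspace on which $\omega$ vanishes. For $\alpha\in\mathbb C\setminus\mathbb R$ and $W$ Lagrangian, the simple element is $p_{\alpha,W}(\lambda)=\frac{\lambda-\alpha}{\lambda-\bar\alpha}\pi_W+\pi_{W^\perp}$, where $\perp$ is the orthogonal complement for the standard hermitian inner product and $\pi_W,\pi_{W^\perp}$ are the orthogonal projections. (The subspace $W'$ is again Lagrangian.) *)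

(* Defs.v *)
From HB Require Import structures.
From mathcomp Require Import all_boot all_order all_algebra.
From mathcomp Require Import complex.
From mathcomp Require Import all_classical all_reals topology normedtype derive.
Import Order.TTheory GRing.Theory Num.Theory numFieldNormedType.Exports.

Set Implicit Arguments.
Unset Strict Implicit.
Unset Printing Implicit Defensive.

Local Open Scope classical_set_scope.
Local Open Scope ring_scope.

(* The ascription as a [numClosedFieldType] makes the topology and the norm
   that MathComp-Analysis puts on every [numFieldType] available on [R[i]]. *)
Definition C (R : realType) : numClosedFieldType := R[i]%C.
Arguments C : simpl never.

Definition hdot (R : realType) m (v w : 'cV[C R]_m) : C R :=
  \sum_i v i 0 * (w i 0)^*.

Definition hbasis (R : realType) m (W : {vspace 'cV[C R]_m}) :
    'M[C R]_(\dim W, m) :=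
  \matrix_(k, i) ((vbasis W)`_k i 0)^*.

(* By [orthcompP], [orthcomp W] is the set of [v] with [hdot v w = 0] for all
   [w] in [W]: the entries of [hbasis W *m v] are the products of [v] with a
   basis of [W]. *)
HB.lock Definition orthcomp (R : realType) m (W : {vspace 'cV[C R]_m}) :
    {vspace 'cV[C R]_m} :=
  lker (linfun (mulmx (hbasis W) : 'cV_m -> 'cV_(\dim W))).

(* The standard matrix of the projection onto [W] along [orthcomp W]. *)
HB.lock Definition orth_proj (R : realType) m (W : {vspace 'cV[C R]_m}) :
    'M[C R]_m :=
  \matrix_(i, j) daddv_pi W (orthcomp W) (delta_mx j 0) i 0.

Section Hermitian.
Variable R : realType.
Local Notation C := (C R).

Lemma orth_projE m (W : {vspace 'cV[C]_m}) (v : 'cV_m) :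
  orth_proj W *m v = daddv_pi W (orthcomp W) v.
Proof.
rewrite unlock {2}(matrix_sum_delta v) linear_sum /=.
apply/matrixP => i j; rewrite (ord1 j) mxE summxE; apply: eq_bigr => k _.
by rewrite big_ord1 linearZ /= !mxE mulrC.
Qed.

Lemma hdot_suml m I (r : seq I) P (F : I -> 'cV[C]_m) w :
  hdot (\sum_(i <- r | P i) F i) w = \sum_(i <- r | P i) hdot (F i) w.
Proof.
rewrite /hdot exchange_big; apply: eq_bigr => k _.
by rewrite summxE mulr_suml.
Qed.

Lemma hdotZl m a (v w : 'cV[C]_m) : hdot (a *: v) w = a * hdot v w.
Proof. by rewrite /hdot mulr_sumr; apply: eq_bigr => i _; rewrite mxE mulrA. Qed.

Lemma hdotC m (v w : 'cV[C]_m) : hdot w v = (hdot v w)^*.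
Proof.
rewrite /hdot rmorph_sum; apply: eq_bigr => i _; by rewrite rmorphM /= conjCK mulrC.
Qed.

Lemma hdot_eq0 m (v : 'cV[C]_m) : hdot v v = 0 -> v = 0.
Proof.
move=> /eqP; rewrite psumr_eq0 => [/allP v0|i _]; last by rewrite mul_conjC_ge0.
apply/matrixP => i j; rewrite (ord1 j) mxE; apply/eqP.
by have := v0 i (mem_index_enum i); rewrite mul_conjC_eq0.
Qed.

Lemma orthcompP m (W : {vspace 'cV[C]_m}) v :
  reflect (forall w, w \in W -> hdot v w = 0) (v \in orthcomp W).
Proof.
have E k : (hbasis W *m v) k 0 = hdot v (vbasis W)`_k.
  by rewrite mxE; apply: eq_bigr => i _; rewrite mxE mulrC.
rewrite unlock memv_ker lfunE /=; apply: (iffP eqP) => [Wv w wW|vW].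
  rewrite (coord_vbasis wW) hdotC hdot_suml big1 ?rmorph0// => k _.
  by rewrite hdotZl hdotC -E Wv mxE conjC0 mulr0.
apply/matrixP => k j; rewrite (ord1 j) E mxE vW //.
by apply/vbasis_mem/mem_nth; rewrite size_tuple.
Qed.

Lemma capv_orthcomp m (W : {vspace 'cV[C]_m}) : (W :&: orthcomp W)%VS = 0%VS.
Proof.
apply/eqP; rewrite -subv0; apply/subvP => v.
by rewrite memv_cap memv0 => /andP[vW /orthcompP/(_ v vW)/hdot_eq0/eqP].
Qed.

Lemma addv_orthcomp m (W : {vspace 'cV[C]_m}) : (W + orthcomp W)%VS = fullv.
Proof.
apply/eqP; rewrite eqEdim subvf /= dimv_disjoint_sum ?capv_orthcomp // unlock.
have := limg_ker_dim (linfun (mulmx (hbasis W) : 'cV_m -> 'cV_(\dim W))) fullv.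
rewrite capfv => <-; rewrite addnC leq_add2r.
by apply: leq_trans (dimvS (subvf _)) _; rewrite dimvf /dim /= muln1.
Qed.

Lemma dim_orthcomp m (W : {vspace 'cV[C]_m}) : (\dim W + \dim (orthcomp W))%N = m.
Proof.
rewrite -dimv_disjoint_sum ?capv_orthcomp // addv_orthcomp dimvf /dim /=.
by rewrite muln1.
Qed.

Lemma orthcompK m (W : {vspace 'cV[C]_m}) : orthcomp (orthcomp W) = W.
Proof.
apply/esym/eqP; rewrite eqEdim; apply/andP; split.
  by apply/subvP => v vW; apply/orthcompP => w /orthcompP/(_ v vW) vw0;
    rewrite hdotC vw0 conjC0.
by rewrite -(leq_add2l (\dim (orthcomp W))) dim_orthcomp addnC dim_orthcomp.
Qed.

Lemma orth_proj_id m (W : {vspace 'cV[C]_m}) (v : 'cV_m) : v \in W -> orth_proj W *m v = v.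
Proof. by move=> vW; rewrite orth_projE daddv_pi_id ?capv_orthcomp. Qed.

Lemma orth_proj_mem m (W : {vspace 'cV[C]_m}) (v : 'cV_m) : orth_proj W *m v \in W.
Proof. by rewrite orth_projE memv_pi. Qed.

Lemma orth_projD m (W : {vspace 'cV[C]_m}) (v : 'cV_m) :
  orth_proj W *m v + orth_proj (orthcomp W) *m v = v.
Proof.
rewrite !orth_projE orthcompK daddv_pi_add ?capv_orthcomp //.
by rewrite addv_orthcomp memvf.
Qed.

Lemma orth_proj_orthcomp m (W : {vspace 'cV[C]_m}) (v : 'cV_m) :
  v \in orthcomp W -> orth_proj W *m v = 0.
Proof.
move=> vW; apply: (addIr v); rewrite add0r -{3}(orth_projD W v).
by rewrite (orth_proj_id vW).
Qed.

End Hermitian.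

Section LinearAlgebra.
Variable R : realType.
Local Notation C := (C R).

Definition symp_mx n : 'M[C]_(n + n) := block_mx 0 1%:M (- 1%:M) 0.

Definition omega n (v w : 'cV[C]_(n + n)) : C := (v^T *m symp_mx n *m w) 0 0.

Definition csp_pred n : {pred 'M[C]_(n + n)} := fun A =>
  (A \in unitmx) &&
  `[< exists c : C, forall v w, omega (A *m v) (A *m w) = c * omega v w >].

Record csp n := Csp { csp_mx :> 'M[C]_(n + n); csp_mxP : csp_pred csp_mx }.

HB.instance Definition _ n := [isSub for @csp_mx n].
HB.instance Definition _ n := [Choice of csp n by <:].

Lemma symp_mx_sqr n : symp_mx n *m symp_mx n = - 1%:M.
Proof.
rewrite /symp_mx mulmx_block !mul0mx !mulmx0 !mul1mx !mulmx1 !addr0 !add0r.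
by rewrite scalar_mx_block opp_block_mx !oppr0.
Qed.

Lemma tr_symp_mx n : (symp_mx n)^T = - symp_mx n.
Proof.
by rewrite /symp_mx tr_block_mx opp_block_mx !linearN /= !trmx0 !trmx1 oppr0 opprK.
Qed.

Lemma csp_unit n (A : csp n) : (A : 'M_(n + n)) \in unitmx.
Proof. by case/andP: (csp_mxP A). Qed.

Lemma csp_omega n (A : csp n) :
  exists c : C, forall v w, omega (A *m v) (A *m w) = c * omega v w.
Proof. by case/andP: (csp_mxP A) => _ /asboolP. Qed.

Lemma omega_nondeg n (v : 'cV[C]_(n + n)) : (forall w, omega w v = 0) -> v = 0.
Proof.
move=> v0; suff Jv : symp_mx n *m v = 0.
  by rewrite -[v]opprK -[X in - X]mul1mx mulmxN -mulNmx -symp_mx_sqr -mulmxA Jv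
     mulmx0 oppr0.
apply/matrixP => i j; rewrite (ord1 j) !mxE.
have := v0 (delta_mx i 0); rewrite /omega -mulmxA trmx_delta -rowE !mxE.
by move=> ->.
Qed.

Lemma csp1_subproof n : csp_pred (1%:M : 'M[C]_(n + n)).
Proof.
rewrite /csp_pred unitmx1; apply/asboolP.
by exists 1 => v w; rewrite !mul1mx mul1r.
Qed.

Lemma cspM_subproof n (A B : csp n) : csp_pred (A *m B).
Proof.
rewrite /csp_pred unitmx_mul !csp_unit; apply/asboolP.
have [[a aP] [b bP]] := (csp_omega A, csp_omega B).
by exists (a * b) => v w; rewrite -!mulmxA aP bP mulrA.
Qed.

Lemma cspV_subproof n (A : csp n) : csp_pred (invmx A).
Proof.
rewrite /csp_pred unitmx_inv csp_unit; apply/asboolP.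
have [a aP] := csp_omega A.
have [a0|a0] := eqVneq a 0.
  exists 1 => v w; rewrite mul1r; have aP' (v' w' : 'cV_(n + n)) : omega v' w' = 0.
    by rewrite -(mulKVmx (csp_unit A) v') -(mulKVmx (csp_unit A) w') aP a0 mul0r.
  by rewrite !aP'.
exists a^-1 => v w.
rewrite -{2}(mulKVmx (csp_unit A) v) -{2}(mulKVmx (csp_unit A) w) aP.
by rewrite mulKf.
Qed.

Definition csp1 n : csp n := Csp (csp1_subproof n).
Definition cspM n (A B : csp n) : csp n := Csp (cspM_subproof A B).
Definition cspV n (A : csp n) : csp n := Csp (cspV_subproof A).

Lemma cspMA n : associative (@cspM n).
Proof. by move=> A B D; apply: val_inj; rewrite /= mulmxA. Qed.
Lemma csp1M n : left_id (csp1 n) (@cspM n).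
Proof. by move=> A; apply: val_inj; rewrite /= mul1mx. Qed.
Lemma cspM1 n : right_id (csp1 n) (@cspM n).
Proof. by move=> A; apply: val_inj; rewrite /= mulmx1. Qed.
Lemma cspVM n : left_inverse (csp1 n) (@cspV n) (@cspM n).
Proof. by move=> A; apply: val_inj; rewrite /= mulVmx ?csp_unit. Qed.
Lemma cspMV n : right_inverse (csp1 n) (@cspV n) (@cspM n).
Proof. by move=> A; apply: val_inj; rewrite /= mulmxV ?csp_unit. Qed.

HB.instance Definition _ n :=
  isGroup.Build (csp n) (@cspMA n) (@csp1M n) (@cspM1 n) (@cspVM n) (@cspMV n).

Record lagrangian n := Lagrangian {
  lag_space :> {vspace 'cV[C]_(n + n)};
  lag_dim : \dim lag_space = n;
  lag_isotropic : forall v w, v \in lag_space -> w \in lag_space -> omega v w = 0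
}.

Lemma mem_img_mulmx m (A : 'M[C]_m) (W : {vspace 'cV[C]_m}) v :
  A \in unitmx -> (v \in (linfun (mulmx A) @: W)%VS) = (invmx A *m v \in W).
Proof.
move=> uA; apply/memv_imgP/idP => [[w wW ->]|vW].
  by rewrite lfunE /= mulKmx.
by exists (invmx A *m v) => //; rewrite lfunE /= mulKVmx.
Qed.

Lemma csp_lag_dim n (A : csp n) (W : lagrangian n) :
  \dim (linfun (mulmx A) @: W)%VS = n.
Proof.
rewrite limg_dim_eq ?lag_dim //; apply/eqP; rewrite -subv0; apply/subvP => v.
rewrite memv_cap memv_ker lfunE /= => /andP[_ /eqP Av0].
by rewrite memv0 -(mulKmx (csp_unit A) v) Av0 mulmx0.
Qed.

Lemma csp_lag_isotropic n (A : csp n) (W : lagrangian n) v w :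
  v \in (linfun (mulmx A) @: W)%VS -> w \in (linfun (mulmx A) @: W)%VS ->
  omega v w = 0.
Proof.
move=> /memv_imgP[v' v'W ->] /memv_imgP[w' w'W ->]; rewrite !lfunE /=.
by have [c ->] := csp_omega A; rewrite (lag_isotropic v'W w'W) mulr0.
Qed.

Definition csp_lag n (A : csp n) (W : lagrangian n) : lagrangian n :=
  Lagrangian (csp_lag_dim A W) (@csp_lag_isotropic n A W).

Lemma lag_maximal n (W : lagrangian n) (u : 'cV_(n + n)) :
  (forall v, v \in (W : {vspace _}) -> omega u v = 0) -> u \in (W : {vspace _}).
Proof.
move=> uW; pose b := vbasis W.
pose B : 'M[C]_(\dim W, n + n) := \matrix_(k, i) b`_k i 0.
have rowB k : row k B = (b`_k)^T by apply/rowP => i; rewrite !mxE.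
have bW (k : 'I_(\dim W)) : b`_k \in (W : {vspace _}).
  by apply/vbasis_mem/mem_nth; rewrite size_tuple.
have mulB (x : 'rV_(\dim W)) : (x *m B)^T = \sum_k x 0 k *: b`_k.
  rewrite mulmx_sum_row linear_sum; apply: eq_bigr => k _.
  by rewrite linearZ /= rowB trmxK.
have freeB : row_free B.
  apply: inj_row_free => x /(congr1 trmx); rewrite mulB trmx0 => x0.
  have /freeP/(_ _ x0) x0' := basis_free (vbasisP W).
  by apply/rowP => k; rewrite x0' mxE.
pose B1 := col_mx B u^T.
have omega_tr (x y : 'cV[C]_(n + n)) :
  x^T *m symp_mx n *m y = (omega x y)%:M by rewrite -mx11_scalar.
have omegaN (x y : 'cV[C]_(n + n)) : omega y x = - omega x y.
  rewrite /omega; suff -> : y^T *m symp_mx n *m x =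
    - (x^T *m symp_mx n *m y)^T by rewrite !mxE.
  by rewrite !trmx_mul trmxK tr_symp_mx mulNmx mulmxN opprK mulmxA.
have B1J0 : (B1 *m symp_mx n) *m B1^T = 0.
  apply/row_matrixP => i; apply/rowP => j.
  suff H (k l : 'I_(\dim W + 1)) : omega (row k B1)^T (row l B1)^T = 0.
    have := H i j; rewrite /omega trmxK -row_mul mxE => E.
    rewrite !mxE -[RHS]E; apply: eq_bigr => s _; rewrite !mxE.
    by congr (_ * _).
  have uu : omega u u = 0.
    by apply/eqP; have /eqP := omegaN u u; rewrite -addr_eq0 -mulr2n mulrn_eq0.
  case: (split_ordP k) => k' ->; case: (split_ordP l) => l' ->;
    rewrite ?rowKu ?rowKd ?rowB ?(row_id, ord1) ?trmxK.
  - by rewrite (lag_isotropic (bW _) (bW _)).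
  - by rewrite omegaN uW ?oppr0.
  - exact: uW.
  - exact: uu.
have uJ : symp_mx n \in unitmx.
  have /mulmx1_unit[] // : symp_mx n *m - symp_mx n = 1%:M.
  by rewrite mulmxN symp_mx_sqr opprK.
have := mulmx0_rank_max B1J0.
rewrite mxrank_tr mxrankMfree ?row_free_unit // => rB1.
have sB : (B <= B1)%MS by rewrite -addsmxE addsmxSl.
have rB : \rank B = n by move/eqP: freeB => ->; rewrite lag_dim.
have : (B1 <= B)%MS.
  rewrite -(geq_leqif (mxrank_leqif_sup sB)) rB -leq_double -!addnn.
  exact: rB1.
rewrite -addsmxE addsmx_sub => /andP[_ /submxP[x /(congr1 trmx)]].
rewrite trmxK mulB => ->; apply: memv_suml => k _; exact/memvZ/bW.
Qed.

Lemma orthcomp_lag n (W : lagrangian n) (v w : 'cV_(n + n)) :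
  v \in orthcomp W -> w \in orthcomp W -> omega v w = 0.
Proof.
move=> vW wW.
have conjJ : map_mx Num.conj (symp_mx n) = symp_mx n.
  by rewrite /symp_mx map_block_mx !raddfN /= !map_mx0 !map_mx1.
pose cj (x : 'cV[C]_(n + n)) := map_mx Num.conj x.
have JTJ : (symp_mx n)^T *m symp_mx n = 1%:M.
  by rewrite tr_symp_mx mulNmx symp_mx_sqr opprK.
have W' (x : 'cV_(n + n)) :
    x \in orthcomp W -> symp_mx n *m cj x \in (W : {vspace _}).
  move=> /orthcompP xW; apply: lag_maximal => y yW.
  rewrite /omega trmx_mul -(mulmxA (cj x)^T) JTJ mulmx1 mxE.
  transitivity (hdot y x); last by rewrite hdotC xW ?conjC0.
  by apply: eq_bigr => i _; rewrite !mxE mulrC.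
have := lag_isotropic (W' _ vW) (W' _ wW).
rewrite /omega trmx_mul -(mulmxA (cj v)^T) JTJ mulmx1 mulmxA.
rewrite -{1}conjJ /cj map_trmx -!map_mxM mxE /= => /eqP.
by rewrite conjC_eq0 => /eqP.
Qed.

Lemma simple_csp_subproof n (W : lagrangian n) (c : C) : c != 0 ->
  csp_pred (c *: orth_proj W + orth_proj (orthcomp W)).
Proof.
move=> c0; set P := orth_proj W; set Q := orth_proj (orthcomp W).
have idP (v : 'cV_(n + n)) : P *m (P *m v) = P *m v.
  by rewrite (orth_proj_id (orth_proj_mem _ _)).
have idQ (v : 'cV_(n + n)) : Q *m (Q *m v) = Q *m v.
  by rewrite (orth_proj_id (orth_proj_mem _ _)).
have PQ (v : 'cV_(n + n)) : P *m (Q *m v) = 0.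
  by rewrite orth_proj_orthcomp ?orth_proj_mem.
have QP (v : 'cV_(n + n)) : Q *m (P *m v) = 0.
  by rewrite orth_proj_orthcomp // orthcompK orth_proj_mem.
have PD (v : 'cV_(n + n)) : P *m v + Q *m v = v by exact: orth_projD.
apply/andP; split.
  have /mulmx1_unit[//] : (c *: P + Q) *m (c^-1 *: P + Q) = 1%:M.
  suff H (v : 'cV_(n + n)) : (c *: P + Q) *m (c^-1 *: P + Q) *m v = v.
    apply/matrixP => i j; have := H (delta_mx j 0).
    by rewrite -colE => /matrixP/(_ i 0); rewrite !mxE eqxx andbT.
  rewrite -mulmxA !(mulmxDl, mulmxDr) -!scalemxAl -!scalemxAr.
  by rewrite idP idQ PQ QP scalerA divff // scale1r !scaler0 addr0 add0r.
apply/asboolP; exists c => v w.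
have oP (x y : 'cV_(n + n)) : omega (P *m x) (P *m y) = 0.
  by apply: (lag_isotropic (l := W)); exact: orth_proj_mem.
have oQ (x y : 'cV_(n + n)) : omega (Q *m x) (Q *m y) = 0.
  by apply: (orthcomp_lag (W := W)); exact: orth_proj_mem.
have oDl (x y z : 'cV[C]_(n + n)) : omega (x + y) z = omega x z + omega y z.
  by rewrite /omega linearD /= !mulmxDl mxE.
have oDr (x y z : 'cV[C]_(n + n)) : omega z (x + y) = omega z x + omega z y.
  by rewrite /omega !mulmxDr mxE.
have oZl (a : C) (x y : 'cV[C]_(n + n)) : omega (a *: x) y = a * omega x y.
  by rewrite /omega linearZ /= -!scalemxAl mxE.
have oZr (a : C) (x y : 'cV[C]_(n + n)) : omega x (a *: y) = a * omega x y.
  by rewrite /omega -scalemxAr mxE.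
rewrite !mulmxDl -!scalemxAl -[in RHS](PD v) -[in RHS](PD w).
by rewrite !(oDl, oDr, oZl, oZr) !oP !oQ !(mulr0, addr0, add0r) mulrDr.
Qed.

End LinearAlgebra.

Section MatrixDerivable.
Variables (K : numFieldType) (V : normedModType K).
Implicit Types (x v : V).

Lemma derivable_mx_entries m k (f : V -> 'M[K]_(m, k)) x v :
  derivable f x v <-> forall i j, derivable (fun y => f y i j : K) x v.
Proof.
split=> [/cvg_ex[/= l fl] i j|df].
  apply/cvg_ex; exists (l i j).
  have := cvg_comp _ _ fl (@coord_continuous K m k i j l).
  by apply: cvg_trans; apply: near_eq_cvg; near=> h; rewrite /= !mxE.
apply/cvg_ex; exists (\matrix_(i, j) 'D_v (fun y => f y i j : K) x).
move=> A [P lP PA].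
have H i j : \forall h \near 0^',
    P i j ((h^-1 *: ((f \o shift x) (h *: v) - f x)) i j).
  have lPij := lP i j; rewrite mxE in lPij.
  have : \forall h \near 0^',
      P i j (h^-1 *: (((fun y => f y i j : K) \o shift x) (h *: v) - f x i j)).
    exact: df i j _ lPij.
  by apply: filterS => h; rewrite !mxE.
have : \forall h \near 0^', forall i j,
    P i j ((h^-1 *: ((f \o shift x) (h *: v) - f x)) i j).
  by apply: filter_forall => i; apply: filter_forall => j; exact: H.
by apply: filterS => h hP; apply: PA => i j; exact: hP.
Unshelve. all: by end_near. Qed.

Lemma derivable_bigsum I (r : seq I) (P : pred I) (h : I -> V -> K) x v :
  (forall i, derivable (h i) x v) ->
  derivable (fun y => \sum_(i <- r | P i) h i y) x v.
Proof.
move=> dh; elim: r => [|i r IH].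
  under eq_fun do rewrite big_nil; exact: derivable_cst.
under eq_fun do rewrite big_cons; case: (P i) => //; exact: derivableD.
Qed.

Lemma derivable_bigprod I (r : seq I) (P : pred I) (h : I -> V -> K) x v :
  (forall i, derivable (h i) x v) ->
  derivable (fun y => \prod_(i <- r | P i) h i y) x v.
Proof.
move=> dh; elim: r => [|i r IH].
  under eq_fun do rewrite big_nil; exact: derivable_cst.
under eq_fun do rewrite big_cons; case: (P i) => //; exact: derivableM.
Qed.

Lemma derivable_mulmx m k l (f : V -> 'M[K]_(m, k)) (g : V -> 'M[K]_(k, l)) x v :
  derivable f x v -> derivable g x v -> derivable (fun y => f y *m g y) x v.
Proof.
move=> /derivable_mx_entries df /derivable_mx_entries dg.
apply/derivable_mx_entries => i j; under eq_fun do rewrite mxE.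
by apply: derivable_bigsum => s; apply: derivableM.
Qed.

Lemma derivable_det m (f : V -> 'M[K]_m) x v :
  (forall i j, derivable (fun y => f y i j : K) x v) ->
  derivable (fun y => \det (f y) : K) x v.
Proof.
move=> df; rewrite /determinant; apply: derivable_bigsum => s.
apply: derivableM; first exact: derivable_cst.
by apply: derivable_bigprod => i.
Qed.

Lemma derivable_invmx m (f : V -> 'M[K]_m) x v :
  (forall y, f y \in unitmx) -> derivable f x v ->
  derivable (fun y => invmx (f y)) x v.
Proof.
move=> fu /derivable_mx_entries df; apply/derivable_mx_entries => i j.
under eq_fun do rewrite /invmx fu !mxE.
apply: derivableM.
  apply: derivableV; last exact: derivable_det.
  by have := fu x; rewrite unitmxE unitfE.
apply: derivableM; first exact: derivable_cst.
apply: derivable_det => i' j'; under eq_fun do rewrite !mxE; exact: df.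
Qed.

End MatrixDerivable.

Notation CP1 R := (one_point_compactification (C R)).

Section RiemannSphere.
Variable R : realType.
Local Notation C := (C R).
Local Notation CP1 := (CP1 R).

(* The coordinate [w = 1 / z] around the point at infinity [None]. *)
Definition chart_infty (w : C) : CP1 := if w == 0 then None else Some w^-1.

(* Only used at all points of an open set, where complex differentiability is
   holomorphy. *)
Definition holo_pt m (g : CP1 -> 'M[C]_m) (z : CP1) : Prop :=
  match z with
  | Some x => derivable (fun y : C => g (Some y)) x 1
  | None => derivable (fun w : C => g (chart_infty w)) 0 1
  end.

Lemma holo_pt_mulmx m (f g : CP1 -> 'M[C]_m) z :
  holo_pt f z -> holo_pt g z -> holo_pt (fun y => f y *m g y) z.
Proof. by case: z => [x|] /=; apply: derivable_mulmx. Qed.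

Lemma holo_pt_invmx m (f : CP1 -> 'M[C]_m) z :
  (forall y, f y \in unitmx) -> holo_pt f z -> holo_pt (fun y => invmx (f y)) z.
Proof.
by case: z => [x|] fu /= df; apply: derivable_invmx => // y; exact: fu.
Qed.

Lemma holo_pt_cst m (A : 'M[C]_m) z : holo_pt (fun=> A) z.
Proof. by case: z => [x|]; exact: derivable_cst. Qed.

Definition avoid2 (a b : C) : set CP1 := [set z | z <> Some a /\ z <> Some b].

Lemma closed1 (a : C) : closed [set a].
Proof. exact/accessible_closed_set1/hausdorff_accessible/norm_hausdorff. Qed.

Lemma near_neq (x c : C) : x <> c -> \forall y \near x, y <> c.
Proof.
by move=> xc; apply: open_nbhs_nbhs; split => //; exact/closed_openC/closed1.
Qed.

Lemma closed2 (a b : C) : closed [set a; b].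
Proof. by apply: closedU; exact: closed1. Qed.

Lemma open_avoid2 (a b : C) : open (avoid2 a b).
Proof.
rewrite openE => -[x|] /= [xa xb].
  have : \forall y \near x, ~ [set a; b] y.
    apply: open_nbhs_nbhs; split; first exact/closed_openC/closed2.
    by move=> -[E|E]; [apply: xa|apply: xb]; rewrite E.
  apply: filterS => y /= yab.
  by split=> -[E]; apply: yab; [left|right].
exists [set a; b].
  split; last exact: closed2.
  by apply: compactU; exact: compact_set1.
move=> z [[y yab <-]|->] //=.
by split=> -[E]; apply: yab; [left|right].
Qed.

Lemma compact_norm_lt (K : set C) :
  compact K -> exists2 M : C, 0 <= M & forall x, K x -> `|x| < M.
Proof.
move=> /compact_near_coveringP cK.
have [M [Mr HM]] : \forall M \near (+oo : set_system C), K `<=` [set x | `|x| < M].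
  apply: cK => x _.
  exists ([set y : C | `|x - y| < 1], [set M : C | `|x| + 1 < M]).
    split=> /=; first by apply/nbhs_ballP; exists 1 => //=.
    by apply: nbhs_pinfty_gt; rewrite realD ?normr_real ?real1.
  move=> [y M] /= [xy xM]; apply: lt_trans xM.
  rewrite -[y](subrK x) addrC; apply: le_lt_trans (ler_normD _ _) _.
  by rewrite ltrD2l distrC.
have MN : M < `|M| + 1.
  by rewrite (le_lt_trans (real_ler_norm Mr)) // ltrDl.
by exists (`|M| + 1); [rewrite addr_ge0|exact: HM].
Qed.

Lemma dense_avoid2 (a b : C) : dense (avoid2 a b).
Proof.
move=> O O0 oO.
suff [x Ox] : exists x, O (Some x).
  have Ox' : nbhs x [set y | O (Some y)].
    by move: oO; rewrite openE => /(_ _ Ox).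
  have neq (c : C) : \forall y \near x^', y != c.
    have [->|xc] := eqVneq c x; first exact: nbhs_dnbhs_neq.
    apply: nbhs_dnbhs; apply: filterS (near_neq _).
      by move=> y yc; apply/eqP; exact: yc.
    by move=> E; rewrite E eqxx in xc.
  have := filter_ex (filterI (nbhs_dnbhs Ox') (filterI (neq a) (neq b))).
  move=> [y [Oy [/eqP ya /eqP yb]]].
  by exists (Some y); split => //; split => -[].
case: O0 => -[x|] Oz; first by exists x.
move: oO; rewrite openE => /(_ _ Oz)[K [cK _]] KO.
have [M M0 KM] := compact_norm_lt cK.
exists M; apply: KO; left; exists M => // /KM.
by rewrite ger0_norm // ltxx.
Qed.

Lemma near_chart_infty (a b : C) :
  \forall w \near (0 : C), avoid2 a b (chart_infty w).
Proof.
have H (c : C) : \forall w \near (0 : C), chart_infty w <> Some c.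
  have [->|c0] := eqVneq c 0.
    near=> w; rewrite /chart_infty; case: eqVneq => // w0 [/eqP].
    by rewrite invr_eq0 (negbTE w0).
  have : (0 : C) <> c^-1 by move=> /eqP; rewrite eq_sym invr_eq0 (negbTE c0).
  move=> /near_neq; apply: filterS => w wc; rewrite /chart_infty.
  by case: eqVneq => // w0 [E]; apply: wc; rewrite -E invrK.
by near=> w; split; near: w; exact: H.
Unshelve. all: by end_near. Qed.

Lemma derivable_continuous1 m (f : C -> 'M[C]_m) x :
  derivable f x 1 -> {for x, continuous f}.
Proof. by move=> /derivable1_diffP/differentiable_continuous. Qed.

Lemma eq_dense m (f g : C -> 'M[C]_m) (V : set C) (D : set CP1) x :
  open V -> V x -> dense D -> derivable f x 1 -> derivable g x 1 ->
  (forall y, V y -> D (Some y) -> f y = g y) -> f x = g x.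
Proof.
move=> oV Vx dD /derivable_continuous1 cf /derivable_continuous1 cg fg.
apply: (@norm_hausdorff _ 'M[C]_m) => A B fA gB.
have VN : nbhs x V by apply: open_nbhs_nbhs.
have : nbhs x (V `&` (f @^-1` A `&` g @^-1` B)).
  by apply: filterI => //; apply: filterI; [exact: cf|exact: cg].
rewrite nbhsE => -[U [oU Ux] UAB].
have [_ [[y Uy <-] Dy]] : (Some @` U : set CP1) `&` D !=set0.
  apply: dD; first by exists (Some x), x.
  exact: one_point_compactification_open_some.
have [Vy [Ay By]] := UAB y Uy.
by exists (f y); split => //; rewrite (fg y).
Qed.

End RiemannSphere.

Section Loops.
Variables (R : realType) (n : nat).
Local Notation C := (C R).
Local Notation CP1 := (CP1 R).
Local Notation csp := (csp R n).

(* [rep_fun] is total; its values outside [rep_dom] are irrelevant. *)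
Record loop_rep := LoopRep {
  rep_dom : set CP1;
  rep_fun :> CP1 -> csp;
  rep_open : open rep_dom;
  rep_dense : dense rep_dom;
  rep_holo : forall z, rep_dom z -> holo_pt (fun y => rep_fun y : 'M[C]_(n + n)) z
}.
Arguments rep_open : clear implicits.
Arguments rep_dense : clear implicits.

HB.instance Definition _ := gen_eqMixin loop_rep.
HB.instance Definition _ := gen_choiceMixin loop_rep.

Definition loop_eqv (g1 g2 : loop_rep) : Prop := exists D : set CP1,
  [/\ open D, dense D, D `<=` rep_dom g1 `&` rep_dom g2
    & forall z, D z -> g1 z = g2 z].

Lemma loop_eqv_refl g : loop_eqv g g.
Proof.
by exists (rep_dom g); split => //; [exact: rep_open|exact: rep_dense].
Qed.

Lemma loop_eqv_sym g1 g2 : loop_eqv g1 g2 -> loop_eqv g2 g1.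
Proof.
move=> [D [oD dD sD eD]]; exists D; split => //.
  by move=> z /sD[].
by move=> z /eD.
Qed.

Lemma loop_eqv_trans g1 g2 g3 :
  loop_eqv g1 g2 -> loop_eqv g2 g3 -> loop_eqv g1 g3.
Proof.
move=> [D [oD dD sD eD]] [E [oE dE sE eE]]; exists (D `&` E); split.
- exact: openI.
- exact: denseI.
- by move=> z [/sD[? ?] /sE[? ?]].
- by move=> z [/eD-> /eE].
Qed.

Definition loop_eqvb : rel loop_rep := fun g1 g2 => `[< loop_eqv g1 g2 >].

Lemma loop_eqvb_refl : reflexive loop_eqvb.
Proof. by move=> g; apply/asboolP/loop_eqv_refl. Qed.
Lemma loop_eqvb_sym : symmetric loop_eqvb.
Proof. by move=> g1 g2; apply/asboolP/asboolP => /loop_eqv_sym. Qed.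
Lemma loop_eqvb_trans : transitive loop_eqvb.
Proof.
move=> g2 g1 g3 /asboolP g12 /asboolP g23.
exact/asboolP/(loop_eqv_trans g12 g23).
Qed.

Canonical loop_equiv :=
  EquivRel loop_eqvb loop_eqvb_refl loop_eqvb_sym loop_eqvb_trans.

Definition loop := {eq_quot loop_equiv}%qT.
HB.instance Definition _ := Choice.on loop.
HB.instance Definition _ := EqQuotient.on loop.

Lemma loop_piP (g1 g2 : loop_rep) :
  loop_eqv g1 g2 <-> (\pi_loop g1 = \pi_loop g2)%qT.
Proof. by split=> [H|/eqmodP/asboolP //]; apply/eqmodP/asboolP. Qed.

Lemma rep_mul_holo (g1 g2 : loop_rep) z : (rep_dom g1 `&` rep_dom g2) z ->
  holo_pt (fun y => (g1 y * g2 y)%g : 'M[C]_(n + n)) z.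
Proof. by move=> [? ?]; apply: holo_pt_mulmx; exact: rep_holo. Qed.

Definition rep_mul (g1 g2 : loop_rep) : loop_rep :=
  LoopRep (openI (rep_open g1) (rep_open g2))
    (denseI (rep_open g1) (rep_dense g1) (rep_dense g2)) (@rep_mul_holo g1 g2).

Lemma rep_inv_holo (g : loop_rep) z : rep_dom g z ->
  holo_pt (fun y => ((g y)^-1)%g : 'M[C]_(n + n)) z.
Proof.
by move=> gz; apply: holo_pt_invmx; [move=> y; exact: csp_unit|exact: rep_holo].
Qed.

Definition rep_inv (g : loop_rep) : loop_rep :=
  LoopRep (rep_open g) (rep_dense g) (@rep_inv_holo g).

Lemma denseT : dense [set: CP1].
Proof. by move=> O O0 _; rewrite setIT. Qed.

Lemma rep_one_holo z : [set: CP1] z ->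
  holo_pt (fun _ => (1%g : csp) : 'M[C]_(n + n)) z.
Proof. by move=> _; exact: holo_pt_cst. Qed.

Definition rep_one : loop_rep := LoopRep openT denseT rep_one_holo.

Definition loop_mul (x y : loop) : loop := (\pi_loop (rep_mul (repr x) (repr y)))%qT.
Definition loop_inv (x : loop) : loop := (\pi_loop (rep_inv (repr x)))%qT.
Definition loop_one : loop := (\pi rep_one)%qT.

Lemma repr_eqv g : loop_eqv (repr (\pi_loop g)%qT) g.
Proof. by apply/loop_piP; rewrite reprK. Qed.

Lemma pi_loop_mul g1 g2 :
  (loop_mul (\pi_loop g1) (\pi_loop g2) = \pi_loop (rep_mul g1 g2))%qT.
Proof.
apply/loop_piP.
have [[D [oD dD sD eD]] [E [oE dE sE eE]]] := (repr_eqv g1, repr_eqv g2).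
exists (D `&` E); split.
- exact: openI.
- exact: denseI.
- by move=> z [/sD[? ?] /sE[? ?]].
- by move=> z [/eD/= -> /eE/= ->].
Qed.

Lemma pi_loop_inv g : (loop_inv (\pi_loop g) = \pi_loop (rep_inv g))%qT.
Proof.
apply/loop_piP; have [D [oD dD sD eD]] := repr_eqv g.
by exists D; split => // z /eD/= ->.
Qed.

Lemma eq_pi_loop g1 g2 : rep_dom g1 = rep_dom g2 -> g1 =1 g2 ->
  (\pi_loop g1 = \pi_loop g2)%qT.
Proof.
move=> ed eg; apply/loop_piP; exists (rep_dom g1); split => //.
- exact: rep_open.
- exact: rep_dense.
- by rewrite -ed setIid.
Qed.

Lemma loop_mulA : associative loop_mul.
Proof.
elim/quotW => x; elim/quotW => y; elim/quotW => z.
rewrite (pi_loop_mul y z) (pi_loop_mul x y).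
rewrite (pi_loop_mul x (rep_mul y z)) (pi_loop_mul (rep_mul x y) z).
by apply: eq_pi_loop => [|t] /=; rewrite ?setIA ?mulgA.
Qed.

Lemma loop_mul1 : left_id loop_one loop_mul.
Proof.
elim/quotW => x; rewrite (pi_loop_mul rep_one x).
by apply: eq_pi_loop => [|t] /=; rewrite ?setTI ?mul1g.
Qed.

Lemma loop_1mul : right_id loop_one loop_mul.
Proof.
elim/quotW => x; rewrite (pi_loop_mul x rep_one).
by apply: eq_pi_loop => [|t] /=; rewrite ?setIT ?mulg1.
Qed.

Lemma loop_mulV : left_inverse loop_one loop_inv loop_mul.
Proof.
elim/quotW => x; rewrite (pi_loop_inv x) (pi_loop_mul (rep_inv x) x).
apply/loop_piP.
exists (rep_dom x); split; [exact: rep_open|exact: rep_dense|by []|].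
by move=> z _ /=; rewrite mulVg.
Qed.

Lemma loop_Vmul : right_inverse loop_one loop_inv loop_mul.
Proof.
elim/quotW => x; rewrite (pi_loop_inv x) (pi_loop_mul x (rep_inv x)).
apply/loop_piP.
exists (rep_dom x); split; [exact: rep_open|exact: rep_dense|by []|].
by move=> z _ /=; rewrite mulgV.
Qed.

HB.instance Definition _ :=
  isGroup.Build loop loop_mulA loop_mul1 loop_1mul loop_mulV loop_Vmul.

Definition rep_extends (g : loop_rep) (a : C) (V : set C) (f : C -> csp) : Prop :=
  [/\ open V, V a,
      forall x, V x -> derivable (fun y => f y : 'M[C]_(n + n)) x 1
    & forall x, V x -> rep_dom g (Some x) -> f x = g (Some x)].

Lemma rep_extends_eqv g1 g2 a V f :
  loop_eqv g1 g2 -> rep_extends g1 a V f -> rep_extends g2 a V f.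
Proof.
move=> [D [oD dD sD eD]] [oV Va dV fg]; split => // x Vx g2x.
apply: val_inj; apply: (eq_dense (g := fun y => g2 (Some y)) oV Vx dD (dV x Vx)).
  exact: (rep_holo g2x).
by move=> y Vy Dy; rewrite fg // ?eD //; have [] := sD _ Dy.
Qed.

Definition loop_extends (h : loop) := rep_extends (repr h).

Lemma pi_loop_extends g a V f :
  loop_extends (\pi_loop g)%qT a V f <-> rep_extends g a V f.
Proof.
by split; apply: rep_extends_eqv; [|apply: loop_eqv_sym]; exact: repr_eqv.
Qed.

Definition loop_holo_at (h : loop) (a : C) : Prop :=
  exists V f, loop_extends h a V f.

(* By [loop_atE] this does not depend on the extension [f]. The default value
   [1] is irrelevant: it is taken only when [h] is not holomorphic at [a]. *)
Definition loop_at (h : loop) (a : C) : csp :=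
  xget 1%g [set A | exists V f, loop_extends h a V f /\ f a = A].

Lemma loop_atE h a V f : loop_extends h a V f -> loop_at h a = f a.
Proof.
move=> hVf; rewrite /loop_at; case: xgetP => [A _ [V' [f' [hVf' <-]]]|H].
  have [oV Va dV fg] := hVf; have [oV' Va' dV' fg'] := hVf'.
  apply: val_inj; have oVV := openI oV oV'.
  apply: (eq_dense (f := fun y => csp_mx (f' y)) (g := fun y => csp_mx (f y))
    oVV (conj Va Va') (rep_dense (repr h))).
  - exact: dV'.
  - exact: dV.
  - by move=> y [Vy V'y] hy; rewrite fg // fg'.
by have := H (f a); case; exists V, f.
Qed.

Definition simple_scalar (a : C) (z : CP1) : C :=
  if z is Some x then (x - a) / (x - a^*) else 1.

Definition simple_mx (a : C) (W : lagrangian R n) (z : CP1) : 'M[C]_(n + n) :=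
  simple_scalar a z *: orth_proj W + orth_proj (orthcomp W).

(* The default value is only taken at [a] and [a^*] (see [simple_funE]). *)
Definition simple_fun (a : C) (W : lagrangian R n) (z : CP1) : csp :=
  insubd (1%g : csp) (simple_mx a W z).

Lemma simple_scalar_neq0 a z : avoid2 a a^* z -> simple_scalar a z != 0.
Proof.
case: z => [x|] [xa xb] //=; last exact: oner_neq0.
rewrite mulf_neq0 ?invr_eq0 // subr_eq0; apply/eqP => E.
  by apply: xa; rewrite E.
by apply: xb; rewrite E.
Qed.

Lemma simple_funE a W z : avoid2 a a^* z ->
  simple_fun a W z = simple_mx a W z :> 'M_(n + n).
Proof.
by move=> az; apply: insubdK; apply: simple_csp_subproof; exact: simple_scalar_neq0.
Qed.

Lemma derivable_affine_frac (p q r s x : C) : r + s * x != 0 ->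
  derivable (fun y : C => (p + q * y) / (r + s * y)) x 1.
Proof.
move=> x0.
have aff (c d : C) : derivable (fun y : C => c + d * y) x 1.
  apply: derivableD; first exact: derivable_cst.
  by apply: derivableM; [exact: derivable_cst|exact: derivable_id].
by apply: derivableM => //; apply: derivableV.
Qed.

Lemma derivable_simple_scalar (f : C -> C) (W : lagrangian R n) x :
  derivable f x 1 ->
  derivable (fun y => f y *: orth_proj W + orth_proj (orthcomp W)) x 1.
Proof.
move=> df; apply/derivable_mx_entries => i j; under eq_fun do rewrite !mxE.
apply: derivableD; last exact: derivable_cst.
by apply: derivableM; last exact: derivable_cst.
Qed.

Lemma simple_holo a W z : avoid2 a a^* z ->
  holo_pt (fun y => simple_fun a W y : 'M[C]_(n + n)) z.
Proof.
case: z => [x|] az /=.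
  apply: (@near_eq_derivable _ _ _ (fun y : C => simple_mx a W (Some y))).
    have : \forall y \near x, avoid2 a a^* (Some y).
      by have := @open_avoid2 R a a^*; rewrite openE => /(_ _ az).
    by apply: filterS => y ay; rewrite simple_funE.
  apply: derivable_simple_scalar.
  rewrite (_ : (fun y => _) = fun y => (- a + 1 * y) / (- a^* + 1 * y)).
    apply: derivable_affine_frac; rewrite mul1r addrC subr_eq0.
    by apply/eqP => E; have [_ []] := az; rewrite E.
  by apply/funext => y /=; rewrite !mul1r ![- _ + y]addrC.
apply: (@near_eq_derivable _ _ _ (fun y : C => simple_mx a W (chart_infty y))).
  by apply: filterS (near_chart_infty a a^*) => w aw; rewrite simple_funE.
apply: derivable_simple_scalar.
rewrite (_ : (fun y => _) = fun y => (1 + - a * y) / (1 + - a^* * y)).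
  by apply: derivable_affine_frac; rewrite mulr0 addr0 oner_neq0.
apply/funext => y; rewrite /chart_infty; case: eqVneq => [->|y0] /=.
  by rewrite !mulr0 addr0 divr1.
have E (c : C) : 1 + - c * y = y * (y^-1 - c).
  by rewrite mulrBr divff // mulNr mulrC.
by rewrite !E invfM mulrACA divff // mul1r.
Qed.

Definition simple_rep (a : C) (W : lagrangian R n) : loop_rep :=
  LoopRep (@open_avoid2 R a a^*) (@dense_avoid2 R a a^*) (@simple_holo a W).

Definition simple_element (a : C) (W : lagrangian R n) : loop :=
  (\pi_loop (simple_rep a W))%qT.

End Loops.

(* Main.v *)
Require Import Defs.
From mathcomp Require Import all_boot all_order all_algebra.
From mathcomp Require Import all_classical all_reals.
From mathcomp Require Import complex topology normedtype derive.
From mathcomp Require Import measure lebesgue_measure lebesgue_integral ring lra.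
Import Order.TTheory GRing.Theory Num.Theory numFieldNormedType.Exports.

(** Write [P], [Q] for the orthogonal projections onto [W] and its complement,
 [P'], [Q'] for those of [W'], and [rho = (z - alpha) / (z - beta)], where
 [beta] is the conjugate of [alpha]. Then
   [p h p'^-1 = P h P' + rho P h Q' + rho^-1 Q h P' + Q h Q'],
 and only [rho^-1] has a pole at [alpha]. Since [h alpha] maps [W'] onto [W],
 the factor [Q h P'] vanishes at [alpha] ([residue_eq0]), which cancels the
 simple pole, provided that [Q h P' / (z - alpha)] extends to a function that
 is complex differentiable at [alpha]; this is [divided_difference]. The value
 of the extension at [alpha] lies in the group because the Gram matrices
 [A^T J A] of [p h p'^-1] and of [h] agree off [alpha] ([gram_conj_simple]),
 hence also at [alpha], and the Gram matrix of [h alpha] is invertible.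

 Holomorphy means complex differentiability at the points of an open set, with
 no continuity of the derivative, so [divided_difference] contains Goursat's
 theorem. A boundary integral of a differentiable function over a rectangle is
 small compared with the square of the size of small rectangles around any
 point, and repeated bisection ([bisection]) then makes it vanish ([goursat]);
 one point where the function is only continuous can be cut out
 ([goursat_except]). Applied to [(f z - f w) / (z - w)] on a square around [0]
 this gives [cauchy_formula]: [L w = f w * K w], where [L w] and [K w] are the
 boundary integrals of [f z / (z - w)] and [1 / (z - w)]. Such integrals are
 differentiable at [w = 0], and so are their divided differences, which are
 integrals of the same kind ([cauchy_sub]). As [K 0 != 0] ([winding_neq0]), the
 divided difference of [f = L / K] is differentiable at [0] too. *)

Set Implicit Arguments.
Unset Strict Implicit.
Unset Printing Implicit Defensive.

Local Open Scope classical_set_scope.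
Local Open Scope ring_scope.

(** * Bisection of rectangles *)

Section Bisection.
Variable R : realType.

Definition rect_subadditive (N : R -> R -> R -> R -> R) (x0 x1 y0 y1 : R) :=
  (forall a b e c d, x0 <= a -> a <= b -> b <= e -> e <= x1 ->
    y0 <= c -> c <= d -> d <= y1 -> N a e c d <= N a b c d + N b e c d) /\
  (forall a b c d e, x0 <= a -> a <= b -> b <= x1 ->
    y0 <= c -> c <= d -> d <= e -> e <= y1 -> N a b c e <= N a b c d + N a b d e).

(** Let [size] be the sum of the two sides. If the conclusion fails, then
 [N > e * size^2] for some [e > 0]. Halving both sides divides [size^2] by 4, so
 one of the quarters inherits the inequality; the quarters chosen successively
 shrink to a point [(p, q)], where the local hypothesis contradicts it. *)
Lemma bisection (N : R -> R -> R -> R -> R) x0 x1 y0 y1 :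
  x0 <= x1 -> y0 <= y1 -> rect_subadditive N x0 x1 y0 y1 ->
  (forall p q e, x0 <= p <= x1 -> y0 <= q <= y1 -> 0 < e -> exists2 del, 0 < del &
    forall a b c d, x0 <= a -> a <= p -> p <= b -> b <= x1 ->
      y0 <= c -> c <= q -> q <= d -> d <= y1 -> (b - a) + (d - c) < del ->
      N a b c d <= e * ((b - a) + (d - c)) ^+ 2) ->
  N x0 x1 y0 y1 <= 0.
Proof.
move=> x01 y01 [Nx Ny] loc; rewrite leNgt; apply/negP => N0.
pose m a b c d : R := ((b - a) + (d - c)) ^+ 2.
(* The summand 1 keeps the denominator positive for degenerate rectangles. *)
pose e := N x0 x1 y0 y1 / (m x0 x1 y0 y1 + 1).
have m1 : 0 < m x0 x1 y0 y1 + 1 by rewrite ltr_wpDl // sqr_ge0.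
have e0 : 0 < e by rewrite divr_gt0.
have bad0 : e * m x0 x1 y0 y1 < N x0 x1 y0 y1.
  by rewrite /e mulrAC ltr_pdivrMr // ltr_pM2l // ltrDl ltr01.
pose X := (R * R * R * R)%type.
pose inv (s : X) := let: (a, b, c, d) := s in
  [/\ [/\ x0 <= a, a <= b & b <= x1], [/\ y0 <= c, c <= d & d <= y1]
    & e * m a b c d < N a b c d].
pose step (s t : X) := inv s -> inv t /\
  let: (a, b, c, d) := s in let: (a', b', c', d') := t in
  [/\ a <= a', b' <= b, c <= c', d' <= d
    & (b' - a') + (d' - c') = ((b - a) + (d - c)) / 2].
have stepP (s : X) : sig (step s).
  apply: cid; case: s => [[[a b] c] d].
  have [H|H] := pselect (inv (a, b, c, d)); last by exists (a, b, c, d) => /H.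
  have [[x0a ab bx1] [y0c cd dy1] bad] := H.
  pose u := (a + b) / 2; pose v := (c + d) / 2.
  have au : a <= u by rewrite /u; lra.
  have ub : u <= b by rewrite /u; lra.
  have cv : c <= v by rewrite /v; lra.
  have vd : v <= d by rewrite /v; lra.
  have x0u := le_trans x0a au; have ux1 := le_trans ub bx1.
  have y0v := le_trans y0c cv; have vy1 := le_trans vd dy1.
  have s1 : (u - a) + (v - c) = ((b - a) + (d - c)) / 2 by rewrite /u /v; field.
  have s2 : (u - a) + (d - v) = ((b - a) + (d - c)) / 2 by rewrite /u /v; field.
  have s3 : (b - u) + (v - c) = ((b - a) + (d - c)) / 2 by rewrite /u /v; field.
  have s4 : (b - u) + (d - v) = ((b - a) + (d - c)) / 2 by rewrite /u /v; field.
  have H1 : N a b c d <= N a u c v + N a u v d + (N u b c v + N u b v d).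
    apply: le_trans (Nx a u b c d _ _ _ _ _ _ _) _ => //.
    by apply: lerD; apply: Ny.
  have mm : m a b c d = 4 * m a u c v by rewrite /m /u /v; field.
  have m2 : m a u v d = m a u c v by rewrite /m s2 s1.
  have m3 : m u b c v = m a u c v by rewrite /m s3 s1.
  have m4 : m u b v d = m a u c v by rewrite /m s4 s1.
  rewrite /step.
  have [B1|B1] := ltP (e * m a u c v) (N a u c v).
    by exists (a, u, c, v) => _.
  have [B2|B2] := ltP (e * m a u v d) (N a u v d).
    by exists (a, u, v, d) => _.
  have [B3|B3] := ltP (e * m u b c v) (N u b c v).
    by exists (u, b, c, v) => _.
  have [B4|B4] := ltP (e * m u b v d) (N u b v d).
    by exists (u, b, v, d) => _.
  exfalso; move: bad; apply/negP; rewrite -leNgt mm; apply: (le_trans H1).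
  rewrite m2 in B2; rewrite m3 in B3; rewrite m4 in B4.
  rewrite (_ : e * (4 * _) = e * m a u c v + e * m a u c v +
    (e * m a u c v + e * m a u c v)); last by ring.
  by rewrite !lerD.
have [f [f0 fS]] := dependent_choice stepP (x0, x1, y0, y1).
pose A n := (f n).1.1.1; pose B n := (f n).1.1.2.
pose Cc n := (f n).1.2; pose D n := (f n).2.
have fE n : f n = (A n, B n, Cc n, D n).
  by rewrite /A /B /Cc /D; case: (f n) => [[[]]].
have finv n : inv (f n).
  elim: n => [|n IH]; first by rewrite f0.
  by have [] := fS n IH.
have st n := (fS n (finv n)).2.
pose s := (x1 - x0) + (y1 - y0).
have size n : (B n - A n) + (D n - Cc n) = s / 2 ^+ n.
  elim: n => [|n IH]; first by rewrite /A /B /Cc /D f0 expr0 divr1.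
  have := st n; rewrite !fE => -[_ _ _ _ ->]; rewrite IH exprS invfM.
  by rewrite mulrCA mulrC.
have monoA : {homo A : n k / (n <= k)%N >-> n <= k}.
  apply: homo_leq => [//|x y z|n]; first exact: le_trans.
  by have := st n; rewrite !fE => -[].
have monoC : {homo Cc : n k / (n <= k)%N >-> n <= k}.
  apply: homo_leq => [//|x y z|n]; first exact: le_trans.
  by have := st n; rewrite !fE => -[].
have monoB : {homo B : n k / (n <= k)%N >-> k <= n}.
  apply: homo_leq => [//|x y z /[swap]|n]; first exact: le_trans.
  by have := st n; rewrite !fE => -[].
have monoD : {homo D : n k / (n <= k)%N >-> k <= n}.
  apply: homo_leq => [//|x y z /[swap]|n]; first exact: le_trans.
  by have := st n; rewrite !fE => -[].
have AB n k : A n <= B k.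
  have := finv (maxn n k); rewrite fE => -[[_ H _] _ _].
  apply: le_trans (le_trans H _); first by apply: monoA; rewrite leq_maxl.
  by apply: monoB; rewrite leq_maxr.
have CD n k : Cc n <= D k.
  have := finv (maxn n k); rewrite fE => -[] _ [_ H _] _.
  apply: le_trans (le_trans H _); first by apply: monoC; rewrite leq_maxl.
  by apply: monoD; rewrite leq_maxr.
pose p := sup (range A); pose q := sup (range Cc).
have Ap n : A n <= p.
  by apply: ub_le_sup; [exists (B 0%N) => _ [k _ <-]|exists n].
have pB n : p <= B n.
  by apply: ge_sup; [exists (A 0%N), 0%N|move=> _ [k _ <-]].
have Cq n : Cc n <= q.
  by apply: ub_le_sup; [exists (D 0%N) => _ [k _ <-]|exists n].
have qD n : q <= D n.
  by apply: ge_sup; [exists (Cc 0%N), 0%N|move=> _ [k _ <-]].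
have [||del del0 locp] := loc p q e _ _ e0.
- by have := Ap 0%N; have := pB 0%N; rewrite /A /B f0 /= => -> ->.
- by have := Cq 0%N; have := qD 0%N; rewrite /Cc /D f0 /= => -> ->.
have [n sn] : exists n, s / 2 ^+ n < del.
  exists (Num.bound (s / del)).
  by rewrite ltr_pdivrMr ?exprn_gt0 // mulrC -ltr_pdivrMr // upper_nthrootP.
have := finv n; rewrite fE => -[[? ? ?] [? ? ?]].
rewrite ltNge => /negP; apply; apply: locp => //.
by rewrite size.
Qed.

End Bisection.

(** * Integrals over segments *)

Section RealIntegral.
Variable R : realType.
Local Notation mu := (@lebesgue_measure R).
Implicit Types (a b c : R) (u v : R -> R).

Definition rint a b u : R := \int[mu]_(t in `[a, b]) u t.
Definition rcont a b u := forall t, a <= t <= b -> {for t, continuous u}.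

Lemma rcont_integrable a b u : rcont a b u ->
  mu.-integrable `[a, b] (EFin \o u).
Proof.
move=> uc; apply: continuous_compact_integrable; first exact: segment_compact.
apply: continuous_in_subspaceT => t /[!inE] /=; rewrite in_itv /=; exact: uc.
Qed.

Lemma eq_rint a b u v :
  (forall t, a <= t <= b -> u t = v t) -> rint a b u = rint a b v.
Proof.
move=> uv; apply: eq_Rintegral => t /[!inE] /=; rewrite in_itv /=; exact: uv.
Qed.

Lemma rintD a b u v : rcont a b u -> rcont a b v ->
  rint a b (fun t => u t + v t) = rint a b u + rint a b v.
Proof. by move=> uc vc; apply: RintegralD => //; exact: rcont_integrable. Qed.

Lemma rintZ a b k u : rcont a b u -> rint a b (fun t => k * u t) = k * rint a b u.
Proof. by move=> uc; apply: RintegralZl => //; exact: rcont_integrable. Qed.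

Lemma rint_cst a b k : a <= b -> rint a b (fun=> k) = k * (b - a).
Proof.
move=> ab; rewrite /rint Rintegral_cst //; congr (_ * _).
rewrite [X in fine X](lebesgue_measure_itv `[a, b]) /= lte_fin.
by move: ab; rewrite le_eqVlt => /predU1P[->|->]; rewrite ?ltxx ?subrr.
Qed.

Lemma rint_norm_le a b u M : a <= b -> rcont a b u ->
  (forall t, a <= t <= b -> `|u t| <= M) -> `|rint a b u| <= M * (b - a).
Proof.
move=> ab uc uM; rewrite -rint_cst //.
apply: le_trans (le_normr_Rintegral _ (rcont_integrable uc)) _ => //.
apply: le_Rintegral => //.
- by apply: rcont_integrable => t tab; apply: cvg_norm; exact: uc.
- by apply: rcont_integrable => t tab; exact: cvg_cst.
Qed.

Lemma rint_chasles a b c u : a <= b -> b <= c -> rcont a c u ->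
  rint a c u = rint a b u + rint b c u.
Proof.
move=> ab bc uc.
have H := rcont_integrable uc.
have := @Rintegral_itvB _ u (BLeft a) (BRight c) b H.
rewrite !bnd_simp => /(_ ab bc) /eqP; rewrite subr_eq addrC => /eqP.
rewrite /rint Rintegral_itv_obnd_cbnd //.
by apply: integrableS H => //; apply: subset_itvr; rewrite bnd_simp.
Qed.

Lemma rint_gt0 a b u k : a < b -> 0 < k -> rcont a b u ->
  (forall t, a <= t <= b -> k <= u t) -> 0 < rint a b u.
Proof.
move=> ab k0 uc uk; have kab : 0 < k * (b - a) by rewrite mulr_gt0 // subr_gt0.
apply: (lt_le_trans kab); rewrite -rint_cst; last exact: ltW.
by apply: le_Rintegral => //; apply: rcont_integrable => // t _; exact: cvg_cst.
Qed.

End RealIntegral.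

Section ComplexPlane.
Variable R : realType.
Local Notation C := (C R).

Definition pt (x y : R) : C := Complex x y.
Definition re (z : C) : R := complex.Re z.
Definition im (z : C) : R := complex.Im z.

Lemma pt_reim z : pt (re z) (im z) = z.
Proof. by case: z. Qed.
Lemma ptD x y x' y' : pt x y + pt x' y' = pt (x + x') (y + y').
Proof. by []. Qed.
Lemma ptN x y : - pt x y = pt (- x) (- y).
Proof. by []. Qed.
Lemma ptM x y x' y' : pt x y * pt x' y' = pt (x * x' - y * y') (x * y' + y * x').
Proof. by []. Qed.
Lemma reD z w : re (z + w) = re z + re w.
Proof. by case: z; case: w. Qed.
Lemma imD z w : im (z + w) = im z + im w.
Proof. by case: z; case: w. Qed.
Lemma reN z : re (- z) = - re z.
Proof. by case: z. Qed.
Lemma imN z : im (- z) = - im z.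
Proof. by case: z. Qed.
Lemma reM z w : re (z * w) = re z * re w - im z * im w.
Proof. by case: z; case: w. Qed.
Lemma imM z w : im (z * w) = re z * im w + im z * re w.
Proof. by case: z; case: w. Qed.
Lemma ltpt x x' : (pt x 0 < pt x' 0) = (x < x').
Proof. exact: ltcR. Qed.

(** The modulus with values in [R]: the norm [`|z|] belongs to [C]. *)
Definition absc (z : C) : R := Normc.normc z.
Lemma normE z : `|z| = pt (absc z) 0.
Proof. by []. Qed.
Lemma absc_ge0 z : 0 <= absc z.
Proof. by case: z => x y; exact: sqrtr_ge0. Qed.
Lemma abscM z w : absc (z * w) = absc z * absc w.
Proof. exact: Normc.normcM. Qed.
Lemma abscV z : absc z^-1 = (absc z)^-1.
Proof. exact: Normc.normcV. Qed.
Lemma abscD z w : absc (z + w) <= absc z + absc w.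
Proof. exact: le_normcD. Qed.
Lemma abscN z : absc (- z) = absc z.
Proof. exact: normcN. Qed.
Lemma absc0 : absc 0 = 0.
Proof. by rewrite /absc /= expr0n /= addr0 sqrtr0. Qed.
Lemma absc_eq0 z : (absc z == 0) = (z == 0).
Proof.
apply/eqP/eqP => [/Normc.eq0_normc //|->].
exact: absc0.
Qed.
Lemma absc_gt0 z : (0 < absc z) = (z != 0).
Proof. by rewrite lt_def absc_ge0 absc_eq0 andbT. Qed.
Lemma absc_re z : `|re z| <= absc z.
Proof.
case: z => x y; rewrite -(sqrtr_sqr x); apply: ler_wsqrtr.
by rewrite lerDl sqr_ge0.
Qed.
Lemma absc_im z : `|im z| <= absc z.
Proof.
case: z => x y; rewrite -(sqrtr_sqr y); apply: ler_wsqrtr.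
by rewrite lerDr sqr_ge0.
Qed.
Lemma absc_le z : absc z <= `|re z| + `|im z|.
Proof.
rewrite -[X in absc X]pt_reim -[pt _ _]addr0.
rewrite (_ : pt _ _ + 0 = pt (re z) 0 + pt 0 (im z)); last first.
  by rewrite addr0 ptD addr0 add0r.
apply: le_trans (abscD _ _) _; rewrite /absc /pt /= expr0n /= addr0 add0r.
by rewrite !sqrtr_sqr.
Qed.

Lemma gt0_pt (e : C) : 0 < e -> e = pt (re e) 0 /\ 0 < re e.
Proof.
by case: e => x y; rewrite ltcE /= => /andP[/eqP -> x0].
Qed.

(** The balls of the topology of [C] have complex radii; this and the next
 lemma replace them by real ones. *)
Lemma nbhs_absc (z : C) (P : set C) :
  nbhs z P <-> exists2 d : R, 0 < d & forall w, absc (w - z) < d -> P w.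
Proof.
split=> [/nbhs_ballP[e /= e0 zP]|[d d0 zP]].
  have [er e0'] := gt0_pt e0; exists (re e) => // w wz; apply: zP.
  by rewrite /ball /= er normE ltpt -abscN opprB.
apply/nbhs_ballP; exists (pt d 0) => /=; first by rewrite -[0]/(pt 0 0) ltpt.
by move=> w; rewrite /ball /= normE ltpt -abscN opprB; exact: zP.
Qed.

Lemma continuous_to_C (T : topologicalType) (f : T -> C) t :
  {for t, continuous f} <->
  forall e : R, 0 < e -> \forall s \near t, absc (f s - f t) < e.
Proof.
split=> [fc e e0|H P /nbhs_absc[d d0 dP]].
  by apply: (fc [set w | absc (w - f t) < e]); apply/nbhs_absc; exists e.
by apply: filterS (H d d0) => s; exact: dP.
Qed.

Lemma re_continuous : continuous re.
Proof.
move=> z P /nbhs_ballP[e /= e0 zP]; apply/nbhs_absc; exists e => // w wz.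
apply: zP; rewrite /ball /= -reN -reD; apply: le_lt_trans (absc_re _) _.
by rewrite -abscN opprB.
Qed.

Lemma im_continuous : continuous im.
Proof.
move=> z P /nbhs_ballP[e /= e0 zP]; apply/nbhs_absc; exists e => // w wz.
apply: zP; rewrite /ball /= -imN -imD; apply: le_lt_trans (absc_im _) _.
by rewrite -abscN opprB.
Qed.

Lemma pt_continuousl y : continuous (pt^~ y).
Proof.
move=> x; apply/continuous_to_C => e e0; apply/nbhs_ballP; exists e => //= s.
rewrite /ball /= distrC; apply: le_lt_trans.
rewrite -[leLHS]/(absc (pt s y - pt x y)) ptN ptD subrr.
by apply: le_trans (absc_le _) _; rewrite /= normr0 addr0.
Qed.

Lemma pt_continuousr x : continuous (pt x).
Proof.
move=> y; apply/continuous_to_C => e e0; apply/nbhs_ballP; exists e => //= s.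
rewrite /ball /= distrC; apply: le_lt_trans.
rewrite -[leLHS]/(absc (pt x s - pt x y)) ptN ptD subrr.
by apply: le_trans (absc_le _) _; rewrite /= normr0 add0r.
Qed.

End ComplexPlane.

Section ComplexIntegral.
Variable R : realType.
Local Notation C := (C R).
Implicit Types (a b : R) (f g : R -> C).

Definition cint a b f : C :=
  pt (rint a b (fun t => re (f t))) (rint a b (fun t => im (f t))).
Definition ccont a b f := forall t, a <= t <= b -> {for t, continuous f}.

Lemma ccont_re a b f : ccont a b f -> rcont a b (fun t => re (f t)).
Proof. by move=> fc t tab; apply: continuous_comp; [exact: fc|exact: re_continuous]. Qed.

Lemma ccont_im a b f : ccont a b f -> rcont a b (fun t => im (f t)).
Proof. by move=> fc t tab; apply: continuous_comp; [exact: fc|exact: im_continuous]. Qed.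

Lemma eq_cint a b f g : (forall t, a <= t <= b -> f t = g t) -> cint a b f = cint a b g.
Proof. by move=> fg; congr pt; apply: eq_rint => t tab; rewrite fg. Qed.

Lemma cintD a b f g : ccont a b f -> ccont a b g ->
  cint a b (fun t => f t + g t) = cint a b f + cint a b g.
Proof.
move=> fc gc; rewrite /cint ptD -!rintD; try exact: ccont_re; try exact: ccont_im.
by congr pt; apply: eq_rint => t _; rewrite ?reD ?imD.
Qed.

Lemma cintZ a b k f : ccont a b f -> cint a b (fun t => k * f t) = k * cint a b f.
Proof.
move=> fc; have [fr fi] := (ccont_re fc, ccont_im fc).
have rcZ u l : rcont a b u -> rcont a b (fun t => l * u t).
  by move=> uc t tab; apply: cvgM; [exact: cvg_cst|exact: uc].
rewrite -[k]pt_reim /cint ptM -mulNr -!rintZ // -!rintD; try exact: rcZ.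
by congr pt; apply: eq_rint => t _; rewrite ?reM ?imM /= ?mulNr.
Qed.

Lemma cint_cst a b k : a <= b -> cint a b (fun=> k) = k * pt (b - a) 0.
Proof.
by move=> ab; rewrite /cint !rint_cst // -[k in RHS]pt_reim ptM !mulr0 subr0 add0r.
Qed.

(** The factor 2 comes from bounding the real and imaginary parts separately. *)
Lemma cint_le a b f M : a <= b -> ccont a b f ->
  (forall t, a <= t <= b -> absc (f t) <= M) -> absc (cint a b f) <= 2 * M * (b - a).
Proof.
move=> ab fc fM; apply: le_trans (absc_le _) _; rewrite -mulrA mulr_natl mulr2n.
apply: lerD; apply: rint_norm_le => //; try exact: ccont_re; try exact: ccont_im.
  by move=> t tab; apply: le_trans (absc_re _) (fM _ tab).
by move=> t tab; apply: le_trans (absc_im _) (fM _ tab).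
Qed.

Lemma cint_chasles a b c f : a <= b -> b <= c -> ccont a c f ->
  cint a c f = cint a b f + cint b c f.
Proof.
move=> ab bc fc; rewrite /cint ptD.
by rewrite (rint_chasles ab bc (ccont_re fc)) (rint_chasles ab bc (ccont_im fc)).
Qed.

End ComplexIntegral.

(** * Goursat's theorem for rectangles *)

Section Goursat.
Variable R : realType.
Local Notation C := (C R).
Implicit Types (f g : C -> C) (z w : C).

(** Differentiability as a first-order expansion with real error bounds. *)
Lemma derivable_absc f z :
  derivable f z 1 <-> exists d : C, forall e : R, 0 < e -> exists2 del : R, 0 < del &
    forall w, absc (w - z) < del -> absc (f w - f z - d * (w - z)) <= e * absc (w - z).
Proof.
split=> [/cvg_ex[/= d fd]|[d fd]].
  exists d => e e0.
  have := fd [set y | absc (y - d) < e]; rewrite /nbhs /= => /(_ _)/nbhs_absc[].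
    by apply/nbhs_absc; exists e.
  move=> del del0 H; exists del => // w wz.
  have [->|wz0] := eqVneq w z; first by rewrite !subrr mulr0 subrr absc0 mulr0.
  have wz1 : w - z != 0 by rewrite subr_eq0.
  have := H (w - z); rewrite subr0 => /(_ wz wz1) /=.
  rewrite /shift /= [_ *: (1 : C)]mulr1 subrK => /ltW.
  have aw : 0 < absc (w - z) by rewrite absc_gt0.
  rewrite -(ler_pM2r aw) -abscM => H'; apply: le_trans H'.
  rewrite le_eqVlt; apply/orP; left; apply/eqP; congr absc.
  by rewrite mulrBl; congr (_ - _); rewrite -[_ *: _]/(_ * _); field.
apply/cvg_ex; exists d => P /nbhs_absc[r r0 dP].
have [|del del0 H] := fd (r / 2); first by rewrite divr_gt0.
apply/nbhs_absc; exists del => // h; rewrite subr0 => hdel h0; apply: dP.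
have := H (h + z); rewrite addrK /= => /(_ hdel) H'.
have ah : 0 < absc h by rewrite absc_gt0.
rewrite -(ltr_pM2r ah) -abscM; apply: (@le_lt_trans _ _ (r / 2 * absc h)).
  apply: le_trans H'; rewrite le_eqVlt; apply/orP; left; apply/eqP; congr absc.
  by rewrite /shift /= [_ *: (1 : C)]mulr1 mulrBl -[_ *: _]/(_ * _); field.
by rewrite ltr_pM2r // ltr_pdivrMr // ltr_pMr // ltr1n.
Qed.

Lemma derivable_continuous f z : derivable f z 1 -> {for z, continuous f}.
Proof. by move=> /derivable1_diffP/differentiable_continuous. Qed.

Definition rect x0 x1 y0 y1 : set C := [set z | x0 <= re z <= x1 /\ y0 <= im z <= y1].
Definition bdry x0 x1 y0 y1 : set C := rect x0 x1 y0 y1 `&`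
  [set z | [\/ re z = x0, re z = x1, im z = y0 | im z = y1]].
Definition cont_on (A : set C) f := forall z, A z -> {for z, continuous f}.

Lemma cont_on_sub (A B : set C) f : A `<=` B -> cont_on B f -> cont_on A f.
Proof. by move=> AB fB z /AB; exact: fB. Qed.

Lemma bdry_rect x0 x1 y0 y1 : bdry x0 x1 y0 y1 `<=` rect x0 x1 y0 y1.
Proof. by move=> z []. Qed.

(** The integral of [f z dz] along the positively oriented boundary, with
 opposite sides paired in one integrand. *)
Definition oint f x0 x1 y0 y1 : C :=
  cint x0 x1 (fun x => f (pt x y0) - f (pt x y1)) +
  pt 0 1 * cint y0 y1 (fun y => f (pt x1 y) - f (pt x0 y)).

Lemma horizontal_ccont f a b y :
  (forall x, a <= x <= b -> {for pt x y, continuous f}) ->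
  ccont a b (fun x => f (pt x y)).
Proof.
by move=> fc x xab; apply: continuous_comp; [exact: pt_continuousl|exact: fc].
Qed.

Lemma vertical_ccont f a b x :
  (forall y, a <= y <= b -> {for pt x y, continuous f}) ->
  ccont a b (fun y => f (pt x y)).
Proof.
by move=> fc y yab; apply: continuous_comp; [exact: pt_continuousr|exact: fc].
Qed.

Lemma ccontB a b (u v : R -> C) :
  ccont a b u -> ccont a b v -> ccont a b (fun t => u t - v t).
Proof. by move=> uc vc t tab; apply: cvgB; [exact: uc|exact: vc]. Qed.

Section Rectangle.
Variables (x0 x1 y0 y1 : R).
Hypotheses (x01 : x0 <= x1) (y01 : y0 <= y1).
Local Notation bd := (bdry x0 x1 y0 y1).

Lemma bdry_bottom x : x0 <= x <= x1 -> bd (pt x y0).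
Proof. by move=> xx; split; [split => //=; rewrite lexx|exact: Or43]. Qed.
Lemma bdry_top x : x0 <= x <= x1 -> bd (pt x y1).
Proof. by move=> xx; split; [split => //=; rewrite lexx andbT|exact: Or44]. Qed.
Lemma bdry_left y : y0 <= y <= y1 -> bd (pt x0 y).
Proof. by move=> yy; split; [split => //=; rewrite lexx|exact: Or41]. Qed.
Lemma bdry_right y : y0 <= y <= y1 -> bd (pt x1 y).
Proof. by move=> yy; split; [split => //=; rewrite lexx andbT|exact: Or42]. Qed.

Lemma oint_horizontal f :
  cont_on bd f -> ccont x0 x1 (fun x => f (pt x y0) - f (pt x y1)).
Proof.
move=> fc; apply: ccontB; apply: horizontal_ccont => x xx; apply: fc.
  exact: bdry_bottom.
exact: bdry_top.
Qed.

Lemma oint_vertical f :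
  cont_on bd f -> ccont y0 y1 (fun y => f (pt x1 y) - f (pt x0 y)).
Proof.
move=> fc; apply: ccontB; apply: vertical_ccont => y yy; apply: fc.
  exact: bdry_right.
exact: bdry_left.
Qed.

Lemma eq_oint f g : (forall z, bd z -> f z = g z) ->
  oint f x0 x1 y0 y1 = oint g x0 x1 y0 y1.
Proof.
move=> fg; rewrite /oint; congr (_ + _ * _); apply: eq_cint => t tt; rewrite !fg //.
- exact: bdry_top.
- exact: bdry_bottom.
- exact: bdry_left.
- exact: bdry_right.
Qed.

Lemma ointD f g : cont_on bd f -> cont_on bd g ->
  oint (fun z => f z + g z) x0 x1 y0 y1 = oint f x0 x1 y0 y1 + oint g x0 x1 y0 y1.
Proof.
move=> fc gc; rewrite /oint [RHS]addrACA -mulrDr -!cintD;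
  try exact: oint_horizontal; try exact: oint_vertical.
by congr (_ + _ * _); apply: eq_cint => t _; rewrite opprD addrACA.
Qed.

Lemma ointZ k f : cont_on bd f ->
  oint (fun z => k * f z) x0 x1 y0 y1 = k * oint f x0 x1 y0 y1.
Proof.
move=> fc; rewrite /oint mulrDr [in RHS]mulrCA.
rewrite -(cintZ k (oint_horizontal fc)) -(cintZ k (oint_vertical fc)).
by congr (_ + _ * _); apply: eq_cint => t _; rewrite mulrBr.
Qed.

Lemma oint_le f M : cont_on bd f -> (forall z, bd z -> absc (f z) <= M) ->
  absc (oint f x0 x1 y0 y1) <= 4 * M * ((x1 - x0) + (y1 - y0)).
Proof.
move=> fc fM; apply: le_trans (abscD _ _) _; rewrite abscM.
have -> : absc (pt 0 1 : C) = 1 by rewrite /absc /pt /= expr0n expr1n add0r sqrtr1.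
have M2 a b : absc a <= M -> absc b <= M -> absc (a - b) <= 2 * M.
  move=> aM bM; apply: le_trans (abscD _ _) _.
  by rewrite abscN mulr_natl mulr2n lerD.
rewrite mul1r mulrDr; apply: lerD; rewrite (_ : 4 * M = 2 * (2 * M)); try ring.
  apply: cint_le => //; first exact: oint_horizontal.
  by move=> t tt; apply: M2; apply: fM; [exact: bdry_bottom|exact: bdry_top].
apply: cint_le => //; first exact: oint_vertical.
by move=> t tt; apply: M2; apply: fM; [exact: bdry_right|exact: bdry_left].
Qed.

(** Opposite sides contribute constants, whose integrals cancel. *)
Lemma oint_affine (a b : C) : oint (fun z => a + b * z) x0 x1 y0 y1 = 0.
Proof.
rewrite /oint (@eq_cint _ _ _ _ (fun=> b * pt 0 (y0 - y1))); last first.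
  by move=> t _ /=; rewrite opprD addrACA subrr add0r -mulrBr ptN ptD subrr.
rewrite [X in _ + _ * X](@eq_cint _ _ _ _ (fun=> b * pt (x1 - x0) 0)); last first.
  by move=> t _; rewrite opprD addrACA subrr add0r -mulrBr ptN ptD subrr.
rewrite !cint_cst // -!mulrA [X in _ + X]mulrCA -mulrDr !ptM ptD -[RHS](mulr0 b).
by congr (_ * _); rewrite -[RHS]/(pt 0 0); congr pt; ring.
Qed.

End Rectangle.

Lemma oint_split_x f a b c y0 y1 : a <= b -> b <= c -> y0 <= y1 ->
  cont_on (rect a c y0 y1) f -> oint f a c y0 y1 = oint f a b y0 y1 + oint f b c y0 y1.
Proof.
move=> ab bc y01 fc; have ac := le_trans ab bc.
have V x : a <= x <= c -> ccont y0 y1 (fun y => f (pt x y)).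
  by move=> xac; apply: vertical_ccont => y yy; apply: fc; split.
rewrite /oint (@cint_chasles _ a b c) //; last first.
  by apply: oint_horizontal => //; apply: cont_on_sub fc; exact: bdry_rect.
rewrite [RHS]addrACA -mulrDr -cintD; [|apply: ccontB; apply: V..];
  rewrite ?lexx ?ab ?bc ?ac //.
by congr (_ + _ * _); apply: eq_cint => y _; rewrite [RHS]addrC subrKA.
Qed.

Lemma oint_split_y f x0 x1 a b c : x0 <= x1 -> a <= b -> b <= c ->
  cont_on (rect x0 x1 a c) f -> oint f x0 x1 a c = oint f x0 x1 a b + oint f x0 x1 b c.
Proof.
move=> x01 ab bc fc; have ac := le_trans ab bc.
have H y : a <= y <= c -> ccont x0 x1 (fun x => f (pt x y)).
  by move=> yac; apply: horizontal_ccont => x xx; apply: fc; split.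
rewrite /oint [X in _ + _ * X](@cint_chasles _ a b c) //; last first.
  by apply: oint_vertical => //; apply: cont_on_sub fc; exact: bdry_rect.
rewrite [RHS]addrACA -mulrDr -cintD; [|apply: ccontB; apply: H..];
  rewrite ?lexx ?ab ?bc ?ac //.
by congr (_ + _ * _); apply: eq_cint => y _; rewrite subrKA.
Qed.

(** At a point of differentiability [f] is affine up to [o(size)], and affine
 functions integrate to 0, so the boundary integral is [o(size^2)]. *)
Lemma goursat f x0 x1 y0 y1 : x0 <= x1 -> y0 <= y1 ->
  (forall z, rect x0 x1 y0 y1 z -> derivable f z 1) -> oint f x0 x1 y0 y1 = 0.
Proof.
move=> x01 y01 df; apply/eqP; rewrite -absc_eq0 eq_le absc_ge0 andbT.
have fc : cont_on (rect x0 x1 y0 y1) f by move=> z /df /derivable_continuous.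
have fcs a b c d : x0 <= a -> b <= x1 -> y0 <= c -> d <= y1 -> cont_on (rect a b c d) f.
  move=> *; apply: cont_on_sub fc => z [/andP[? ?] /andP[? ?]].
  by split; apply/andP; split; lra.
apply: (bisection (N := fun a b c d => absc (oint f a b c d))) => //.
  split=> [a b e c d|a b c d e] *.
    rewrite (@oint_split_x f a b) //; first exact: abscD.
    exact: fcs.
  rewrite (@oint_split_y f a b c d) //; first exact: abscD.
  exact: fcs.
move=> p q e pp qq e0.
have /derivable_absc[dv fd] : derivable f (pt p q) 1 by apply: df.
have [|del del0 H] := fd (e / 4); first by rewrite divr_gt0.
exists del => // a b c d xa ap pb bx yc cq qd dy small.
pose s := (b - a) + (d - c).
pose g z := f z - (f (pt p q) - dv * pt p q + dv * z).
have ab : a <= b by lra.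
have cd : c <= d by lra.
have affc u v : continuous (fun z : C => u + v * z).
  move=> z; apply: (@derivable_continuous (fun z => u + v * z)).
  apply: derivableD; first exact: derivable_cst.
  by apply: derivableM; [exact: derivable_cst|exact: derivable_id].
have bc : cont_on (bdry a b c d) f.
  by apply: cont_on_sub (fcs a b c d _ _ _ _) => //; exact: bdry_rect.
have gc : cont_on (bdry a b c d) g.
  by move=> z zb; apply: continuousB; [exact: bc|exact: affc].
have -> : oint f a b c d =
    oint (fun z => (f (pt p q) - dv * pt p q + dv * z) + g z) a b c d.
  by apply: eq_oint => // z _; rewrite /g addrC subrK.
have ac : cont_on (bdry a b c d) (fun z => f (pt p q) - dv * pt p q + dv * z).
  by move=> z _; exact: affc.
rewrite (ointD ab cd ac gc) (oint_affine ab cd) add0r.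
have gs z : bdry a b c d z -> absc (g z) <= e / 4 * s.
  move=> [[/andP[az zb] /andP[cz zd]] _].
  have zs : absc (z - pt p q) <= s.
    apply: le_trans (absc_le _) _; rewrite reD imD reN imN /= /s.
    apply: lerD; rewrite ler_norml; lra.
  apply: (@le_trans _ _ (e / 4 * absc (z - pt p q))); last first.
    by rewrite ler_pM2l // divr_gt0.
  apply: le_trans (H _ (le_lt_trans zs small)).
  rewrite le_eqVlt; apply/orP; left; apply/eqP; congr absc.
  by rewrite /g; ring.
apply: le_trans (oint_le ab cd gc gs) _.
by rewrite le_eqVlt; apply/orP; left; apply/eqP; rewrite /s; field.
Qed.

(** One end of the cut around [p]: either at distance [del], or at the end [x] of
 the side, where the remaining strip is degenerate. *)
Lemma near_left (x p del : R) : 0 < del -> x <= p ->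
  exists a, [/\ x <= a, a <= p, p - del <= a & x = a \/ a < p].
Proof.
move=> d0 xp; have [?|?] := leP x (p - del); first by exists (p - del); split; lra.
exists x; split; [exact: lexx|exact: xp|exact: ltW|by left].
Qed.

Lemma near_right (x p del : R) : 0 < del -> p <= x ->
  exists b, [/\ p <= b, b <= x, b <= p + del & b = x \/ p < b].
Proof.
move=> d0 px; have [?|?] := leP (p + del) x; first by exists (p + del); split; lra.
exists x; split; [exact: px|exact: lexx|exact: ltW|by left].
Qed.

(** Cutting out the part within [del] of [p] in both coordinates leaves four
 rectangles that avoid [p] or are degenerate; the rest contributes [O(del)]. *)
Lemma goursat_except f x0 x1 y0 y1 p : x0 <= x1 -> y0 <= y1 -> rect x0 x1 y0 y1 p ->
  cont_on (rect x0 x1 y0 y1) f ->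
  (forall z, rect x0 x1 y0 y1 z -> z != p -> derivable f z 1) -> oint f x0 x1 y0 y1 = 0.
Proof.
move=> x01 y01 [/andP[x0p px1] /andP[y0p py1]] fc df; apply/eqP; apply/negPn/negP => J0.
have fcs a b c d : x0 <= a -> b <= x1 -> y0 <= c -> d <= y1 -> cont_on (rect a b c d) f.
  move=> *; apply: cont_on_sub fc => z [/andP[? ?] /andP[? ?]].
  by split; apply/andP; split; lra.
have away a b c d : x0 <= a -> a <= b -> b <= x1 -> y0 <= c -> c <= d -> d <= y1 ->
    ~ rect a b c d p -> oint f a b c d = 0.
  move=> xa ab bx yc cd dy Np; apply: goursat => // z zr; apply: df.
    by case: zr => /andP[? ?] /andP[? ?]; split; apply/andP; split; lra.
  by apply/eqP => zp; apply: Np; rewrite -zp.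
have flatx a c d : x0 <= a <= x1 -> y0 <= c -> c <= d -> d <= y1 -> oint f a a c d = 0.
  move=> /andP[xa ax] yc cd dy.
  have /eqP := @oint_split_x f a a a c d (lexx a) (lexx a) cd (fcs _ _ _ _ xa ax yc dy).
  by rewrite -subr_eq0 opprD addrA subrr sub0r oppr_eq0 => /eqP.
have flaty a b c : x0 <= a -> a <= b -> b <= x1 -> y0 <= c <= y1 -> oint f a b c c = 0.
  move=> xa ab bx /andP[yc cy].
  have /eqP := @oint_split_y f a b c c c ab (lexx c) (lexx c) (fcs _ _ _ _ xa bx yc cy).
  by rewrite -subr_eq0 opprD addrA subrr sub0r oppr_eq0 => /eqP.
have /continuous_to_C/(_ 1 ltr01)/nbhs_absc[r r0 fp] : {for p, continuous f}.
  by apply: fc; split; apply/andP.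
pose M := absc (f p) + 1.
have M0 : 0 < M by rewrite ltr_wpDl // absc_ge0.
have small del : 0 < del -> 2 * del < r -> absc (oint f x0 x1 y0 y1) <= 16 * M * del.
  move=> del0 delr.
  have [a [xa ap pa Ha]] := near_left del0 x0p.
  have [b [pb bx bp Hb]] := near_right del0 px1.
  have [c [yc cq qc Hc]] := near_left del0 y0p.
  have [d [qd dy dq Hd]] := near_right del0 py1.
  have ab := le_trans ap pb; have cd := le_trans cq qd.
  have ax1 := le_trans ab bx; have cy1 := le_trans cd dy.
  have x0b := le_trans xa ab; have y0d := le_trans yc cd.
  rewrite (@oint_split_x f x0 a x1) // (@oint_split_x f a b x1) //; last exact: fcs.
  rewrite (@oint_split_y f a b y0 c y1) //; last exact: fcs.
  rewrite (@oint_split_y f a b c d y1) //; last exact: fcs.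
  have -> : oint f x0 a y0 y1 = 0.
    case: Ha => [<-|Ha]; first by rewrite flatx ?lexx.
    by apply: away => // -[/andP[H1 H2] _]; move: Ha; rewrite ltNge H2.
  have -> : oint f b x1 y0 y1 = 0.
    case: Hb => [->|Hb]; first by rewrite flatx ?lexx ?x01.
    by apply: away => // -[/andP[H1 H2] _]; move: Hb; rewrite ltNge H1.
  have -> : oint f a b y0 c = 0.
    case: Hc => [<-|Hc]; first by rewrite flaty ?lexx.
    by apply: away => // -[_ /andP[H1 H2]]; move: Hc; rewrite ltNge H2.
  have -> : oint f a b d y1 = 0.
    case: Hd => [->|Hd]; first by rewrite flaty ?lexx ?y01.
    by apply: away => // -[_ /andP[H1 H2]]; move: Hd; rewrite ltNge H1.
  rewrite !addr0 !add0r.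
  have bc : cont_on (bdry a b c d) f.
    by apply: (cont_on_sub (@bdry_rect a b c d)); exact: fcs.
  have bM z : bdry a b c d z -> absc (f z) <= M.
    move=> [[/andP[az zb] /andP[cz zd]] _].
    have zp : absc (z - p) < r.
      apply: le_lt_trans (absc_le _) _; rewrite reD imD reN imN.
      apply: (@le_lt_trans _ _ (del + del)); last lra.
      by apply: lerD; rewrite ler_norml; lra.
    rewrite -[f z](subrK (f p)) addrC; apply: le_trans (abscD _ _) _.
    by rewrite lerD2l ltW // fp.
  apply: le_trans (oint_le ab cd bc bM) _.
  rewrite (_ : 16 * M * del = 4 * M * (4 * del)); last by ring.
  rewrite ler_pM2l; last by rewrite mulr_gt0.
  lra.
have := absc_gt0 (oint f x0 x1 y0 y1); rewrite J0; set j := absc _ => j0.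
have := small (Num.min (r / 4) (j / (32 * M))); rewrite -/j => /(_ _ _)/wrap[].
- by rewrite lt_min !divr_gt0 ?mulr_gt0.
- by apply: (@le_lt_trans _ _ (2 * (r / 4))); [rewrite ler_pM2l // ge_min lexx|lra].
apply/negP; rewrite -ltNge; apply: (@le_lt_trans _ _ (16 * M * (j / (32 * M)))).
  by rewrite ler_pM2l ?mulr_gt0 // ge_min lexx orbT.
rewrite (_ : 16 * M * (j / (32 * M)) = j / 2); first lra.
by field; exact: lt0r_neq0.
Qed.

End Goursat.

(** * Cauchy's formula on a square *)

Section CauchyTransform.
Variable R : realType.
Local Notation C := (C R).
Implicit Types (f phi : C -> C) (z w : C).
Variable r : R.
Hypothesis r0 : 0 < r.
Local Notation bd := (bdry (- r) r (- r) r).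

Let rr : - r <= r.
Proof. by rewrite ge0_cp ?ltW. Qed.

Let half_lt : r / 2 < r.
Proof. by rewrite ltr_pdivrMr // ltr_pMr // ltr1n. Qed.

Lemma square_bdry_far z : bd z -> r <= absc z.
Proof.
have H x : x = r \/ x = - r -> r <= `|x|.
  by move=> [->|->]; rewrite ?normrN ger0_norm // ltW.
by move=> [_ [] E];
  [apply: le_trans (H _ _) (absc_re z)..|apply: le_trans (H _ _) (absc_im z)|
   apply: le_trans (H _ _) (absc_im z)]; rewrite E; [right|left|right|left].
Qed.

Lemma square_interior w : absc w < r -> rect (- r) r (- r) r w.
Proof.
move=> wr; have := le_lt_trans (absc_re w) wr; have := le_lt_trans (absc_im w) wr.
by rewrite !ltr_norml => /andP[? ?] /andP[? ?]; split; apply/andP; split; apply: ltW.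
Qed.

Lemma square_bdry_neq w z : absc w < r -> bd z -> z - w != 0.
Proof.
move=> wr /square_bdry_far rz; rewrite subr_eq0; apply/eqP => E.
by move: rz; rewrite E leNgt wr.
Qed.

Lemma derivable_kernel w z : z - w != 0 -> derivable (fun y : C => (y - w)^-1) z 1.
Proof.
by move=> zw; apply: derivableV.
Qed.

Lemma cont_kernel phi w :
  absc w < r -> cont_on bd phi -> cont_on bd (fun z => phi z / (z - w)).
Proof.
move=> wr pc z zb; apply: continuousM; first exact: pc.
by apply: derivable_continuous; apply: derivable_kernel; exact: square_bdry_neq zb.
Qed.

Definition cauchy phi w := oint (fun z => phi z / (z - w)) (- r) r (- r) r.

(** The form [z - 0] makes this the integrand of [cauchy phi 0]. *)
Definition over_z phi z := phi z / (z - 0).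

Definition admissible phi :=
  cont_on bd phi /\ exists M : R, forall z, bd z -> absc (phi z) <= M.

Lemma over_z_admissible phi : admissible phi -> admissible (over_z phi).
Proof.
move=> [pc [M pM]]; split; first by apply: cont_kernel => //; rewrite absc0.
exists (M / r) => z zb; rewrite /over_z subr0 abscM abscV.
have az := lt_le_trans r0 (square_bdry_far zb).
apply: ler_pM; rewrite ?absc_ge0 ?invr_ge0 ?absc_ge0 //; first exact: pM.
by rewrite lef_pV2 ?posrE // square_bdry_far.
Qed.

(** [1 / (z - w) - 1 / z = w / (z * (z - w))]. *)
Lemma cauchy_sub phi w : admissible phi -> absc w < r ->
  cauchy phi w - cauchy phi 0 = w * cauchy (over_z phi) w.
Proof.
move=> pa wr; have [pc _] := pa; have [qc _] := over_z_admissible pa.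
have c1 := cont_kernel wr qc.
have c0 : cont_on bd (over_z phi) := qc.
have cw : cont_on bd (fun z => w * (over_z phi z / (z - w))).
  by move=> z zb; apply: continuousM; [exact: cst_continuous|exact: c1].
apply/eqP; rewrite subr_eq addrC; apply/eqP.
rewrite -(ointZ rr rr w c1) -(ointD rr rr c0 cw); apply: eq_oint => // z zb.
have zw := square_bdry_neq wr zb.
have z0 : z - 0 != 0 by apply: square_bdry_neq zb; rewrite absc0.
rewrite /over_z; move: z0; rewrite subr0 => z0; field.
by rewrite zw z0.
Qed.

(** [|z - w| >= r / 2] when [z] is on the boundary and [|w| <= r / 2]. *)
Lemma cauchy_bounded phi : admissible phi ->
  exists2 M : R, 0 < M & forall w, absc w <= r / 2 -> absc (cauchy phi w) <= M.
Proof.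
move=> [pc [M pM]]; pose M' := Num.max M 1.
have M'0 : 0 < M' by rewrite lt_max ltr01 orbT.
have pM' z : bd z -> absc (phi z) <= M' by move=> /pM H; rewrite le_max H.
exists (4 * (M' / (r / 2)) * ((r - - r) + (r - - r))).
  by rewrite !mulr_gt0 ?invr_gt0 ?divr_gt0 // opprK !addr_gt0.
move=> w wr; have wr' := le_lt_trans wr half_lt.
apply: (oint_le rr rr (cont_kernel wr' pc)) => z zb.
rewrite abscM abscV; apply: ler_pM; rewrite ?invr_ge0 ?absc_ge0 //.
  exact: pM'.
have rz := square_bdry_far zb.
have : absc z <= absc (z - w) + absc w by rewrite -{1}(subrK w z) abscD.
move=> H; rewrite lef_pV2 ?posrE ?divr_gt0 //; lra.
Qed.

(** Two applications of [cauchy_sub] give an error term [O(w ^ 2)]. *)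
Lemma cauchy_derivable phi : admissible phi -> derivable (cauchy phi) 0 1.
Proof.
move=> pa; have p1 := over_z_admissible pa; have p2 := over_z_admissible p1.
have [M M0 HM] := cauchy_bounded p2.
apply/derivable_absc; exists (cauchy (over_z phi) 0) => e e0.
exists (Num.min (r / 2) (e / M)); first by rewrite lt_min !divr_gt0.
move=> w; rewrite subr0 lt_min => /andP[wr we].
have wr' := lt_trans wr half_lt.
rewrite (cauchy_sub pa wr') mulrC -mulrBl (cauchy_sub p1 wr') abscM.
apply: ler_wpM2r; first exact: absc_ge0.
rewrite abscM; apply: (@le_trans _ _ (e / M * M)).
  by apply: ler_pM (absc_ge0 _) (absc_ge0 _) (ltW we) (HM _ (ltW wr)).
by rewrite divfK // lt0r_neq0.
Qed.

Lemma ptV (x y : R) :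
  (pt x y)^-1 = pt (x / (x ^+ 2 + y ^+ 2)) (- (y / (x ^+ 2 + y ^+ 2))).
Proof. by []. Qed.

Lemma cst1_admissible : admissible (fun=> 1).
Proof.
split; first by move=> z _; exact: cst_continuous.
by exists (absc 1) => z _.
Qed.

(** The integral of [1 / z]. On each pair of opposite sides its imaginary part is
 the integral of [2 * r / (t ^+ 2 + r ^+ 2)], whose values are at least [1 / r]. *)
Lemma winding_neq0 : cauchy (fun=> 1) 0 != 0.
Proof.
apply/eqP => /(congr1 (@im R)).
have kc : cont_on bd (fun z => 1 / (z - 0)).
  by apply: cont_kernel; [rewrite absc0|exact: cst1_admissible.1].
have hc := ccont_im (oint_horizontal rr kc); have vc := ccont_re (oint_vertical rr kc).
rewrite /cauchy /oint imD imM /= mul0r add0r mul1r; apply/eqP/lt0r_neq0.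
have q t : - r <= t <= r -> r^-1 <= 2 * r / (t ^+ 2 + r ^+ 2).
  move=> /andP[t1 t2]; have r2 : 0 < r ^+ 2 by rewrite exprn_gt0.
  have t0 : 0 <= t ^+ 2 by rewrite sqr_ge0.
  have tr : t ^+ 2 <= r ^+ 2 by nra.
  rewrite ler_pdivlMr ?ltr_wpDl // mulrC ler_pdivrMr //; nra.
have lr : - r < r by rewrite gt0_cp.
have ri : 0 < r^-1 by rewrite invr_gt0.
apply: addr_gt0.
  apply: (rint_gt0 lr ri hc) => t /q /le_trans; apply.
  rewrite !subr0 !mul1r !ptV ptN ptD /= sqrrN le_eqVlt; apply/orP; left; apply/eqP.
  by field; rewrite lt0r_neq0 // ltr_wpDl ?sqr_ge0 ?exprn_gt0.
apply: (rint_gt0 lr ri vc) => t /q /le_trans; apply.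
rewrite !subr0 !mul1r !ptV ptN ptD /= sqrrN le_eqVlt; apply/orP; left; apply/eqP.
by field; rewrite lt0r_neq0 // ltr_wpDr ?sqr_ge0 ?exprn_gt0.
Qed.

(** The divided difference of [f] at [w] is continuous at [w], where its value is
 the derivative, and differentiable elsewhere, so [goursat_except] applies. *)
Lemma cauchy_formula f w : (forall z, rect (- r) r (- r) r z -> derivable f z 1) ->
  absc w < r -> cauchy f w = f w * cauchy (fun=> 1) w.
Proof.
move=> df wr.
have fc : cont_on bd f by move=> z [/df /derivable_continuous].
have wq := square_interior wr.
have [d fd] := (derivable_absc f w).1 (df w wq).
pose h z := if z == w then d else (f z - f w) / (z - w).
have dh z : rect (- r) r (- r) r z -> z != w -> derivable h z 1.
  move=> zq zw; apply: (@near_eq_derivable _ _ _ (fun z => (f z - f w) / (z - w))).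
    have : \forall y \near z, y <> w by apply: near_neq; exact/eqP.
    by apply: filterS => y /eqP yw; rewrite /h (negbTE yw).
  apply: derivableM; last by apply: derivable_kernel; rewrite subr_eq0.
  by apply: derivableB; [exact: df|exact: derivable_cst].
have hc : cont_on (rect (- r) r (- r) r) h.
  move=> z zq; have [->|zw] := eqVneq z w; last exact/derivable_continuous/dh.
  apply/continuous_to_C => e e0; apply/nbhs_absc.
  have [|del del0 H] := fd (e / 2); first by rewrite divr_gt0.
  exists del => // y yw; rewrite /h eqxx; case: eqVneq => [_|ynw].
    by rewrite subrr absc0.
  have yw0 : y - w != 0 by rewrite subr_eq0.
  have ay : 0 < absc (y - w) by rewrite absc_gt0.
  rewrite -(ltr_pM2r ay) -abscM mulrBl divfK //.
  apply: le_lt_trans (H _ yw) _.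
  by rewrite ltr_pM2r // ltr_pdivrMr // ltr_pMr // ltr1n.
have := goursat_except rr rr wq hc dh.
have c1 := cont_kernel wr fc.
have c2 := cont_kernel wr cst1_admissible.1.
have c3 : cont_on bd (fun z => - f w * (1 / (z - w))).
  by move=> z zb; apply: continuousM; [exact: cst_continuous|exact: c2].
have -> : oint h (- r) r (- r) r =
    oint (fun z => f z / (z - w) + - f w * (1 / (z - w))) (- r) r (- r) r.
  apply: eq_oint => // z zb; have zw := square_bdry_neq wr zb.
  rewrite /h ifN; last by rewrite -subr_eq0.
  by rewrite div1r mulrBl mulNr.
rewrite (ointD rr rr c1 c3) (ointZ rr rr (- f w) c2) mulNr => /eqP.
by rewrite subr_eq0 => /eqP.
Qed.

End CauchyTransform.

(** * Divided differences *)

Section DividedDifference.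
Variable R : realType.
Local Notation C := (C R).
Implicit Types (f : C -> C).

Lemma derivable_quotient (a b c : C -> C) (l k z : C) :
  derivable a z 1 -> derivable b z 1 -> derivable c z 1 -> c z != 0 -> k != 0 ->
  derivable (fun w => (a w * k - l * b w) / (c w * k)) z 1.
Proof.
move=> da db dc c0 k0.
have dcst (u : C) : derivable (fun=> u : C) z 1 by exact: derivable_cst.
have d1 : derivable (fun w => a w * k) z 1 := derivableM da (dcst k).
have d2 : derivable (fun w => l * b w) z 1 := derivableM (dcst l) db.
have d3 : derivable (fun w => c w * k) z 1 := derivableM dc (dcst k).
have d4 := derivableB d1 d2.
have d5 : derivable (fun w => (c w * k)^-1) z 1.
  by apply: derivableV d3; rewrite mulf_neq0.
exact: (derivableM d4 d5).
Qed.

Lemma divided_difference0 f : (\forall z \near (0 : C), derivable f z 1) ->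
  exists k : C -> C, derivable k 0 1 /\ \forall z \near (0 : C), f z = f 0 + z * k z.
Proof.
move=> ndf; have /nbhs_absc[r1 r10 df] := ndf.
have fc0 : {for 0, continuous f}.
  by apply: derivable_continuous; exact: nbhs_singleton ndf.
have /continuous_to_C/(_ 1 ltr01)/nbhs_absc[r2 r20 fb] := fc0.
(* A point of the square has modulus at most [2 * r], below both radii. *)
pose r := Num.min r1 r2 / 3.
have m0 : 0 < Num.min r1 r2 by rewrite lt_min r10.
have r0 : 0 < r by rewrite divr_gt0.
have near_sq z : rect (- r) r (- r) r z -> absc (z - 0) < Num.min r1 r2.
  move=> [/andP[? ?] /andP[? ?]]; rewrite subr0.
  apply: le_lt_trans (absc_le _) _; apply: (@le_lt_trans _ _ (r + r)).
    by apply: lerD; rewrite ler_norml; apply/andP.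
  by rewrite /r; lra.
have dfq z : rect (- r) r (- r) r z -> derivable f z 1.
  by move=> /near_sq; rewrite lt_min => /andP[/df].
have fa : admissible r f.
  split; first by move=> z [/dfq /derivable_continuous].
  exists (absc (f 0) + 1) => z [/near_sq]; rewrite lt_min => /andP[_ /fb /ltW fz] _.
  rewrite -[f z](subrK (f 0)) addrC; apply: le_trans (abscD _ _) _.
  by rewrite lerD2l.
(* [f = L / K], and [L1], [K1] are the divided differences of [L], [K] at 0. *)
pose K := cauchy r (fun=> 1); pose L := cauchy r f.
pose K1 := cauchy r (over_z (fun=> 1)); pose L1 := cauchy r (over_z f).
have a1 := cst1_admissible r.
have dK : derivable K 0 1 := cauchy_derivable r0 a1.
have dK1 : derivable K1 0 1 := cauchy_derivable r0 (over_z_admissible r0 a1).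
have dL1 : derivable L1 0 1 := cauchy_derivable r0 (over_z_admissible r0 fa).
have K0 : K 0 != 0 := winding_neq0 r0.
exists (fun w => (L1 w * K 0 - L 0 * K1 w) / (K w * K 0)); split.
  exact: (@derivable_quotient L1 K1 K (L 0) (K 0) 0 dL1 dK1 dK K0 K0).
have nK : \forall w \near (0 : C), K w != 0.
  have := derivable_continuous dK => /continuous_to_C/(_ (absc (K 0))).
  rewrite absc_gt0 => /(_ K0); apply: filterS => w; apply: contraTneq => ->.
  by rewrite sub0r abscN ltxx.
have nr : \forall w \near (0 : C), absc w < r.
  by apply/nbhs_absc; exists r => // w; rewrite subr0.
apply: filterS (filterI nK nr) => w [Kw wr].
have absc00 : absc (0 : C) < r by rewrite absc0.
have fw : L w = f w * K w := cauchy_formula r0 dfq wr.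
have f0 : L 0 = f 0 * K 0 := cauchy_formula r0 dfq absc00.
have EL : L w - L 0 = w * L1 w := cauchy_sub r0 fa wr.
have EK : K w - K 0 = w * K1 w := cauchy_sub r0 a1 wr.
rewrite mulrA mulrBr (mulrA w (L1 w)) (mulrCA w (L 0)) -EL -EK fw f0.
by field; rewrite Kw K0.
Qed.

(** The removal of the singularity of [(f z - f a) / (z - a)] at [a]. *)
Lemma divided_difference f a : (\forall z \near a, derivable f z 1) ->
  exists k : C -> C, derivable k a 1 /\ \forall z \near a, f z = f a + (z - a) * k z.
Proof.
move=> /nbhs_absc[r r0 df].
have [|k [dk fk]] := @divided_difference0 (fun z => f (z + a)).
  apply/nbhs_absc; exists r => // z; rewrite subr0 => zr.
  have /derivable_absc[d H] := df (z + a) ltac:(by rewrite addrK).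
  apply/derivable_absc; exists d => e /H[del del0 Hd]; exists del => // w wz.
  have E : w + a - (z + a) = w - z by rewrite opprD addrACA subrr addr0.
  by have := Hd (w + a); rewrite E; apply.
exists (fun z => k (z - a)); split.
  have /derivable_absc[d H] := dk.
  apply/derivable_absc; exists d => e /H[del del0 Hd]; exists del => // w wz.
  by have := Hd (w - a); rewrite subrr !subr0; apply.
move: fk => /nbhs_absc[del del0 H]; apply/nbhs_absc; exists del => // z za.
by have := H (z - a); rewrite subr0 subrK add0r; apply.
Qed.

End DividedDifference.

(** * Conjugation of a loop by simple elements *)

Lemma sandwich_expand (K : fieldType) m (c : K) (P Q A P' Q' : 'M[K]_m) : c != 0 ->
  (c *: P + Q) *m A *m (c^-1 *: P' + Q') =
  P *m A *m P' + c *: (P *m A *m Q') + c^-1 *: (Q *m A *m P') + Q *m A *m Q'.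
Proof.
move=> c0; rewrite mulmxDr !mulmxDl -!scalemxAr -!scalemxAl.
by rewrite scalerA mulVf // scale1r -!addrA; congr (_ + _); rewrite addrCA.
Qed.

Lemma isotropic_expand (K : fieldType) m (a : K) (P Q J : 'M[K]_m) :
  P^T *m J *m P = 0 -> Q^T *m J *m Q = 0 ->
  (a *: P + Q)^T *m J *m (a *: P + Q) = a *: (P^T *m J *m Q + Q^T *m J *m P).
Proof.
move=> PJP QJQ; have -> : (a *: P + Q)^T = a *: P^T + Q^T.
  by apply/matrixP => i j; rewrite !mxE.
rewrite !mulmxDl !mulmxDr -!scalemxAl -!scalemxAr.
by rewrite PJP QJQ !scaler0 add0r addr0 scalerDr.
Qed.

Lemma mx_bilinear_ext (K : fieldType) m (A B : 'M[K]_m) :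
  (forall v w : 'cV_m, (v^T *m A *m w) 0 0 = (v^T *m B *m w) 0 0) -> A = B.
Proof.
move=> AB; apply/matrixP => i j; have := AB (delta_mx i 0) (delta_mx j 0).
by rewrite trmx_delta -!colE -!rowE !mxE.
Qed.

Lemma mx_bilinear_eq0 (K : fieldType) m (A : 'M[K]_m) :
  (forall v w : 'cV_m, (v^T *m A *m w) 0 0 = 0) -> A = 0.
Proof.
by move=> A0; apply: mx_bilinear_ext => v w; rewrite A0 mulmx0 mul0mx mxE.
Qed.

Lemma mx_bilinear_scale (K : fieldType) m (c : K) (A B : 'M[K]_m) :
  (forall v w : 'cV_m, (v^T *m A *m w) 0 0 = c * (v^T *m B *m w) 0 0) ->
  A = c *: B.
Proof.
move=> AB; apply: mx_bilinear_ext => v w.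
by rewrite AB -scalemxAr -scalemxAl [RHS]mxE.
Qed.

Section MatrixLoops.
Variable R : realType.
Local Notation C := (C R).

Lemma derivable_scalemx m k (s : C -> C) (f : C -> 'M[C]_(m, k)) x :
  derivable s x 1 -> derivable f x 1 -> derivable (fun z => s z *: f z) x 1.
Proof.
move=> ds /derivable_mx_entries df; apply/derivable_mx_entries => i j.
by under eq_fun do rewrite mxE; apply: derivableM ds (df i j).
Qed.

Lemma divided_difference_mx m (f : C -> 'M[C]_m) a :
  (\forall z \near a, derivable f z 1) ->
  exists k : C -> 'M[C]_m,
    derivable k a 1 /\ \forall z \near a, f z = f a + (z - a) *: k z.
Proof.
move=> df.
have H (ij : 'I_m * 'I_m) : exists k : C -> C, derivable k a 1 /\
    \forall z \near a, f z ij.1 ij.2 = f a ij.1 ij.2 + (z - a) * k z.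
  apply: (@divided_difference _ (fun z => f z ij.1 ij.2)).
  by apply: filterS df => z /derivable_mx_entries.
have [k kP] := choice H.
exists (fun z => \matrix_(i, j) k (i, j) z); split.
  apply/derivable_mx_entries => i j; under eq_fun do rewrite mxE.
  exact: (kP (i, j)).1.
have FF : Filter (nbhs a) := nbhs_filter a.
have := @filter_forall _ _ _ (nbhs a) FF (fun ij => (kP ij).2).
by apply: filterS => z fz; apply/matrixP => i j; rewrite !mxE; exact: (fz (i, j)).
Qed.

Lemma mulmx_ext m k (A B : 'M[C]_(m, k)) : (forall v : 'cV_k, A *m v = B *m v) -> A = B.
Proof.
move=> AB; apply/matrixP => i j; have /matrixP/(_ i 0) := AB (delta_mx j 0).
by rewrite -!colE !mxE.
Qed.

Section Projections.
Variables (m : nat) (W : {vspace 'cV[C]_m}).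
Local Notation P := (orth_proj W).
Local Notation Q := (orth_proj (orthcomp W)).

Lemma orth_proj_idem : P *m P = P.
Proof. by apply: mulmx_ext => v; rewrite -mulmxA orth_proj_id ?orth_proj_mem. Qed.

Lemma orth_proj_mul_compl : P *m Q = 0.
Proof.
apply: mulmx_ext => v.
by rewrite -mulmxA mul0mx orth_proj_orthcomp ?orth_proj_mem.
Qed.

Lemma orth_proj_compl : P + Q = 1%:M.
Proof. by apply: mulmx_ext => v; rewrite mulmxDl mul1mx orth_projD. Qed.

End Projections.

Definition simple n (c : C) (W : lagrangian R n) : 'M[C]_(n + n) :=
  c *: orth_proj W + orth_proj (orthcomp W).

Lemma simple_mulV n (W : lagrangian R n) (c : C) : c != 0 ->
  simple c W *m simple c^-1 W = 1%:M.
Proof.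
move=> c0; have QP := orth_proj_mul_compl (orthcomp W); rewrite orthcompK in QP.
rewrite mulmxDl !mulmxDr -!scalemxAl -!scalemxAr !orth_proj_idem QP.
rewrite orth_proj_mul_compl scalerA divff // scale1r !scaler0 addr0 add0r.
exact: orth_proj_compl.
Qed.

Section Symplectic.
Variable n : nat.
Implicit Types (A B : 'M[C]_(n + n)) (W : lagrangian R n).
Local Notation J := (symp_mx R n).

Definition gram A := A^T *m J *m A.

Lemma omega_mul A B (v w : 'cV[C]_(n + n)) :
  omega (A *m v) (B *m w) = (v^T *m (A^T *m J *m B) *m w) 0 0.
Proof. by rewrite /omega trmx_mul !mulmxA. Qed.

Lemma csp_gram (A : csp R n) : exists c : C, gram A = c *: J.
Proof.
have [c cP] := csp_omega A; exists c; apply: mx_bilinear_scale => v w.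
exact: etrans (esym (omega_mul A A v w)) (cP v w).
Qed.

Lemma gram_mul A B : gram (A *m B) = B^T *m gram A *m B.
Proof. by rewrite /gram trmx_mul !mulmxA. Qed.

(** [W] and its orthogonal complement are both isotropic, so only the cross terms
 survive; they scale by [c], and add up to [J] for [c = 1]. *)
Lemma gram_simple W (c : C) : gram (simple c W) = c *: J.
Proof.
rewrite /simple; set P := orth_proj W; set Q := orth_proj (orthcomp W).
have PJP : P^T *m J *m P = 0.
  apply: mx_bilinear_eq0 => v w; rewrite -omega_mul.
  by apply: (lag_isotropic (l := W)); exact: orth_proj_mem.
have QJQ : Q^T *m J *m Q = 0.
  apply: mx_bilinear_eq0 => v w; rewrite -omega_mul.
  by apply: (orthcomp_lag (W := W)); exact: orth_proj_mem.
have E a : gram (a *: P + Q) = a *: (P^T *m J *m Q + Q^T *m J *m P).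
  exact: isotropic_expand.
have J1 : gram (P + Q) = J by rewrite orth_proj_compl /gram trmx1 mul1mx mulmx1.
by rewrite E; have := E 1; rewrite !scale1r J1 => <-.
Qed.

(** The invertible matrix [gram A] has [B] as a right factor. *)
Lemma csp_of_gram (A : csp R n) B : gram B = gram A -> csp_pred B.
Proof.
move=> BA; have uJ : J \in unitmx.
  have /mulmx1_unit[] // : J *m - J = 1%:M by rewrite mulmxN symp_mx_sqr opprK.
have : gram B \in unitmx.
  by rewrite BA /gram !unitmx_mul unitmx_tr csp_unit uJ.
rewrite /gram unitmx_mul => /andP[_ uB]; rewrite /csp_pred uB; apply/asboolP.
have [c cP] := csp_omega A; exists c => v w.
by rewrite omega_mul -/(gram B) BA -omega_mul cP.
Qed.

End Symplectic.

(** [A] maps the range of the right factor into [W]. *)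
Lemma residue_eq0 n (W : lagrangian R n) (A : csp R n) :
  orth_proj (orthcomp W) *m A *m orth_proj (csp_lag A^-1%g W) = 0.
Proof.
apply: mulmx_ext => v; rewrite -!mulmxA mul0mx orth_proj_orthcomp // orthcompK.
have := orth_proj_mem (lag_space (csp_lag A^-1%g W)) v.
by rewrite mem_img_mulmx ?csp_unit //= invmxK.
Qed.

Lemma neq_conj (alpha : C) : alpha \isn't Num.real -> alpha != alpha^*.
Proof. by rewrite CrealE eq_sym. Qed.

Lemma invmx_simple n (c : C) (W : lagrangian R n) :
  c != 0 -> invmx (simple c W) = simple c^-1 W.
Proof.
move=> c0; have SV := simple_mulV W c0; have [uS _] := mulmx1_unit SV.
by rewrite -[RHS](mulKmx uS) SV mulmx1.
Qed.

Lemma simple_sandwich n (c : C) (W W' : lagrangian R n) (A : 'M[C]_(n + n)) : c != 0 ->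
  simple c W *m A *m simple c^-1 W' =
  orth_proj W *m A *m orth_proj W' +
  c *: (orth_proj W *m A *m orth_proj (orthcomp W')) +
  c^-1 *: (orth_proj (orthcomp W) *m A *m orth_proj W') +
  orth_proj (orthcomp W) *m A *m orth_proj (orthcomp W').
Proof. exact: sandwich_expand. Qed.

(** The conformal factors [c] and [c^-1] of the two simple elements cancel. *)
Lemma gram_conj_simple n (c : C) (W W' : lagrangian R n) (A : csp R n) :
  c != 0 -> gram (simple c W *m A *m simple c^-1 W') = gram A.
Proof.
move=> c0; have [d Ad] := csp_gram A.
rewrite gram_mul (gram_mul _ A) gram_simple -scalemxAr -scalemxAl -/(gram A) Ad.
rewrite -!scalemxAr -!scalemxAl -/(gram _) gram_simple !scalerA mulrAC divff //.
by rewrite mul1r.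
Qed.

Lemma derivable_mulmx3 m (A B : 'M[C]_m) (f : C -> 'M[C]_m) x :
  derivable f x 1 -> derivable (fun z => A *m f z *m B) x 1.
Proof.
move=> df; have dA := derivable_cst A x 1; have dB := derivable_cst B x 1.
exact: (derivable_mulmx (derivable_mulmx dA df) dB).
Qed.

Lemma derivable_gram n (f : C -> 'M[C]_(n + n)) x :
  derivable f x 1 -> derivable (fun z => gram (f z)) x 1.
Proof.
move=> df; have dJ := derivable_cst (symp_mx R n) x 1.
have dT : derivable (fun z => (f z)^T) x 1.
  apply/derivable_mx_entries => i j; under eq_fun do rewrite mxE.
  exact: (derivable_mx_entries _ _ _).1 df j i.
exact: (derivable_mulmx (derivable_mulmx dT dJ) df).
Qed.

End MatrixLoops.

Theorem theorem4p2 (R : realType) (n : nat) (alpha : C R)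
    (W : lagrangian R n) (h : loop R n) :
  alpha \isn't Num.real ->
  loop_holo_at h alpha ->
  let W' := csp_lag (loop_at h alpha)^-1%g W in
  loop_holo_at (simple_element alpha W * h * (simple_element alpha W')^-1)%g
    alpha.
Proof.
move=> /neq_conj na [V [f hf]]; rewrite (loop_atE hf) => W'.
have [oV Va df fh] := hf.
set P := orth_proj W; set Q := orth_proj (orthcomp W).
set P' := orth_proj W'; set Q' := orth_proj (orthcomp W').
(* [F0] is the conjugated loop away from [alpha] and its conjugate. *)
pose F0 z : csp R n :=
  (simple_fun alpha W (Some z) * f z * (simple_fun alpha W' (Some z))^-1)%g.
pose rho z := simple_scalar alpha (Some z).
pose fm z : 'M[C R]_(n + n) := f z.
have ndf : \forall z \near alpha, derivable fm z 1.
  by apply: filterS (open_nbhs_nbhs (conj oV Va)) => z /df.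
have dfa : derivable fm alpha 1 := nbhs_singleton ndf.
have dB : \forall z \near alpha, derivable (fun z => Q *m fm z *m P') z 1.
  by apply: filterS ndf => z; exact: derivable_mulmx3.
have [k [dk kE]] := divided_difference_mx dB.
rewrite (_ : Q *m fm alpha *m P' = 0) in kE; last exact: residue_eq0.
have nB : nbhs alpha [set z | Q *m fm z *m P' = (z - alpha) *: k z].
  by apply: filterS kE => z /= ->; rewrite add0r.
(* The expansion of [F0] with [rho^-1 Q h P'] rewritten, as [Q h P' = (z - alpha) k]. *)
pose G z := P *m fm z *m P' + rho z *: (P *m fm z *m Q') +
  (z - alpha^*) *: k z + Q *m fm z *m Q'.
have av z : z != alpha -> z != alpha^* -> avoid2 alpha alpha^* (Some z).
  by move=> /eqP z1 /eqP z2; split => -[].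
have rho0 z : z != alpha -> z != alpha^* -> rho z != 0.
  by move=> z1 z2; apply: simple_scalar_neq0; exact: av.
have F0S z : z != alpha -> z != alpha^* ->
    F0 z = simple (rho z) W *m fm z *m simple (rho z)^-1 W' :> 'M_(n + n).
  move=> z1 z2; rewrite -(invmx_simple W' (rho0 z z1 z2)).
  have -> : F0 z = csp_mx (simple_fun alpha W (Some z)) *m csp_mx (f z) *m
    invmx (csp_mx (simple_fun alpha W' (Some z))) :> 'M_(n + n) by [].
  by congr (_ *m _ *m invmx _); exact: simple_funE (av z z1 z2).
have F0E z : z != alpha -> z != alpha^* -> Q *m fm z *m P' = (z - alpha) *: k z ->
    F0 z = G z :> 'M_(n + n).
  move=> z1 z2 Bz; rewrite F0S // /G.
  have E : (z - alpha^*) *: k z = (rho z)^-1 *: (Q *m fm z *m P').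
    by rewrite Bz scalerA /rho /= invf_div divfK // subr_eq0.
  by rewrite E simple_sandwich // rho0.
have drho : derivable rho alpha 1.
  have d1 : derivable (fun z => z - alpha) alpha 1.
    by apply: derivableB; [exact: derivable_id|exact: derivable_cst].
  have d2 : derivable (fun z : C R => (z - alpha^*)^-1) alpha 1.
    by apply: derivable_kernel; rewrite subr_eq0.
  exact: derivableM d1 d2.
have dG : derivable G alpha 1.
  have d3 : derivable (fun z => z - alpha^*) alpha 1.
    by apply: derivableB; [exact: derivable_id|exact: derivable_cst].
  have e1 := derivable_mulmx3 (A := P) (B := P') dfa.
  have e2 := derivable_scalemx drho (derivable_mulmx3 (A := P) (B := Q') dfa).
  have e3 := derivable_scalemx d3 dk.
  have e4 := derivable_mulmx3 (A := Q) (B := Q') dfa.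
  exact: (derivableD (derivableD (derivableD e1 e2) e3) e4).
(* Both sides are continuous at [alpha] and agree off [alpha] and its conjugate. *)
have gramG : gram (G alpha) = gram (f alpha).
  have := nB; rewrite nbhsE => -[U [oU Ua] UB].
  apply: (eq_dense (f := fun z => gram (G z)) (g := fun z => gram (fm z)) oU Ua
    (@dense_avoid2 R alpha alpha^*)).
  - exact: derivable_gram.
  - exact: derivable_gram.
  move=> y Uy [ya yb].
  have y1 : y != alpha by apply/eqP => E; apply: ya; rewrite E.
  have y2 : y != alpha^* by apply/eqP => E; apply: yb; rewrite E.
  rewrite -F0E // ?F0S //; first by rewrite gram_conj_simple ?rho0.
  exact: UB.
have cspG := csp_of_gram gramG.
pose F z := if z == alpha then Csp cspG else F0 z.
pose V2 : set (C R) := V `&` ~` [set alpha^*].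
have oV2 : open V2 by apply: openI => //; apply: closed_openC; exact: closed1.
have V2a : V2 alpha by split => //=; exact/eqP.
have GF : {near alpha, G =1 (fun z => F z : 'M_(n + n))}.
  apply: filterS (filterI nB (open_nbhs_nbhs (conj oV2 V2a))) => z [Bz [_ /eqP z2]].
  by rewrite /F; have [->|z1] := eqVneq z alpha; [|exact/esym/F0E].
have Fh : rep_extends (rep_mul (rep_mul (simple_rep alpha W) (repr h))
    (rep_inv (simple_rep alpha W'))) alpha V2 F.
  split; [exact: oV2|exact: V2a| |].
    move=> x [Vx /eqP x2]; have [->|x1] := eqVneq x alpha.
      exact: (near_eq_derivable GF dG).
    have F0F : {near x, (fun z => F0 z : 'M_(n + n)) =1
        (fun z => F z : 'M_(n + n))}.
      apply: filterS (near_neq (elimN eqP x1)) => z /eqP z1.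
      by rewrite /F (negbTE z1).
    apply: (near_eq_derivable F0F).
    have ax := av x x1 x2.
    have p1 := @simple_holo _ _ alpha W _ ax.
    have p2 := @rep_inv_holo _ _ (simple_rep alpha W') _ ax.
    exact: (derivable_mulmx (derivable_mulmx p1 (df x Vx)) p2).
  move=> x [Vx _] [[[xa _] hx] _]; rewrite /F ifN.
    by rewrite /F0 fh.
  by apply/eqP => E; apply: xa; rewrite E.
exists V2, F.
have -> : (simple_element alpha W * h * (simple_element alpha W')^-1)%g =
    (\pi_(loop R n) (rep_mul (rep_mul (simple_rep alpha W) (repr h))
      (rep_inv (simple_rep alpha W'))))%qT.
  rewrite -[h in LHS]reprK.
  by rewrite -pi_loop_mul -pi_loop_mul -pi_loop_inv.
by apply/pi_loop_extends.
Qed.
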